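(* Let $P$ and $Q$ be irreducible stochastic matrices over countable sets $\Omega_P$ and $\Omega_Q$ respectively. Suppose that $\rho(P)=\rho(Q)$ and that at least one of $P$, $Q$ is strong Liouville. Then there is an isometric isomorphism $\varphi:\mathcal T_+(P)\to\mathcal T_+(Q)$ of algebras if and only if $P$ and $Q$ are conjugate.
   Context: A stochastic matrix over a countable set $\Omega$ is a function $P:\Omega\times\Omega\to[0,1]$ with $\sum_{j\in\Omega}P_{ij}=1$ for all $i\in\Omega$. Write $P_{ij}^{(n)}=(P^n)_{ij}$ for integers $n\ge 0$, with $P^{(0)}=I$. $\mathrm{Gr}(P)$ is the directed graph on $\Omega$ with a directed edge $(i,j)$ exactly when $P_{ij}>0$, and $(i,j)\in\mathrm{Gr}(P^n)$ means $P^{(n)}_{ij}>0$. $P$ is irreducible if $\mathrm{Gr}(P)$ is strongly connected. Spectral radius: for irreducible $P$, $\rho(P)=\limsup_{n}\sqrt[n]{P_{ii}^{(n)}}$, which does not depend on $i\in\Omega$. Strong Liouville: a function $h:\Omega\to\mathbb R$ is harmonic for $P$ if $Ph=h$, i.e. $\sum_jP_{ij}h(j)=h(i)$ for all $i$. An irreducible $P$ is strong Liouville if all positive harmonic functions for $P$ are constant. Conjugacy: $P$ over $\Omega_P$ and $Q$ over $\Omega_Q$ are conjugate if there is a bijection $\sigma:\Omega_P\to\Omega_Q$ with $P_{ij}=Q_{\sigma(i)\sigma(j)}$ for every $(i,j)\in\mathrm{Gr}(P)$. Tensor algebra $\mathcal T_+(P)$: for $k\in\Omega$ let $\mathcal H_{P,k}$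 be the Hilbert space with orthonormal basis $\{\xi_{m,j,k}: m\ge 0,\ j\in\Omega,\ (j,k)\in\mathrm{Gr}(P^m)\}$, and let $\mathcal H_P=\bigoplus_{k\in\Omega}\mathcal H_{P,k}$. For $n\ge0$ let $\mathrm{Arv}(P)_n$ be the set of complex matrices $A=[a_{ij}]$ over $\Omega$ with $a_{ij}=0$ whenever $(i,j)\notin\mathrm{Gr}(P^n)$ and $\sup_{j\in\Omega}\sum_{i\in\Omega}|a_{ij}|^2<\infty$. For $A\in\mathrm{Arv}(P)_n$ define the bounded operator $S_A^{(n)}$ on $\mathcal H_P$ by $$S_A^{(n)}(\xi_{m,j,k})=\sum_{i\in\Omega}a_{ij}\sqrt{\frac{P_{ij}^{(n)}P_{jk}^{(m)}}{P_{ik}^{(n+m)}}}\;\xi_{n+m,i,k},$$ where terms with $a_{ij}=0$ are taken to be $0$. Then $\mathcal T_+(P)\subseteq B(\mathcal H_P)$ is the norm-closed algebra (not necessarily self-adjoint) generated by $\{S_A^{(n)}: A\in\mathrm{Arv}(P)_n,\ n\ge0\}$, with the operator norm. *)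

(* Defs.v *)
From HB Require Import structures.
From mathcomp Require Import all_boot all_order all_algebra.
From mathcomp Require Import all_classical all_reals all_analysis.
From mathcomp Require Import complex ring.

Set Implicit Arguments.
Unset Strict Implicit.
Unset Printing Implicit Defensive.

Import Order.TTheory GRing.Theory Num.Theory.
Import ComplexField.Normc.

Local Open Scope classical_set_scope.
Local Open Scope ring_scope.

(* [esum] (possibly infinite sum in the extended reals) is only the intended
   sum for nonnegative families; every use below is of that kind. *)

Section StochasticMatrices.
Context {R : realType} {T : countType}.
Implicit Types (P : T -> T -> R) (h : T -> R).

Definition stochastic P : Prop :=
  (forall i j, 0 <= P i j <= 1) /\
  (forall i, (\esum_(j in [set: T]) (P i j)%:E = 1)%E).

Fixpoint mpow P (n : nat) (i j : T) : R :=
  if n is n'.+1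
  then fine (\esum_(k in [set: T]) (P i k * mpow P n' k j)%:E)
  else (i == j)%:R.

Definition Gr P : rel T := fun i j => 0 < P i j.

Definition irreducible P : Prop :=
  forall i j, exists s : seq T, path (Gr P) i s /\ last i s = j.

(* For irreducible P this is independent of the base point i. *)
Definition spectral_radius P (i : T) : \bar R :=
  limn_esup (fun n : nat => (mpow P n i i `^ n%:R^-1)%:E).

Definition positive_harmonic P h : Prop :=
  (forall i, 0 < h i) /\
  (forall i, (\esum_(j in [set: T]) (P i j * h j)%:E = (h i)%:E)%E).

Definition strong_liouville P : Prop :=
  forall h, positive_harmonic P h -> forall i j, h i = h j.

End StochasticMatrices.

Definition conjugate {R : realType} {T U : countType}
    (P : T -> T -> R) (Q : U -> U -> R) : Prop :=
  exists sigma : T -> U, bijective sigma /\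
    (forall i j, Gr P i j -> P i j = Q (sigma i) (sigma j)).

(* The complex Hilbert space of square-summable families indexed by I, that is,
   the Hilbert space with orthonormal basis (ket i) for i in I. *)
Section Ell2.
Context {R : realType} {I : choiceType}.

Definition sqnorm (x : I -> R[i]) : \bar R :=
  (\esum_(i in [set: I]) (normc (x i) ^+ 2)%:E)%E.

Definition square_summable : {pred I -> R[i]} :=
  [pred x | (sqnorm x < +oo)%E].

Lemma square_summable_submod : GRing.submod_closed square_summable.
Proof.
split=> [|a x y].
  rewrite inE /sqnorm esum1 ?ltry// => i _.
  by rewrite normc0 expr0n.
rewrite !inE => xoo yoo.
set c := 2 * (normc a ^+ 2).
have n0 (z : R[i]) : (0 <= (normc z ^+ 2)%:E)%E by rewrite lee_fin sqr_ge0.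
have c0 : 0 <= c by rewrite mulr_ge0 ?sqr_ge0.
have esumZ (k : R) (z : I -> R[i]) : 0 <= k -> (sqnorm z < +oo)%E ->
    (\esum_(i in [set: I]) (k * normc (z i) ^+ 2)%:E < +oo)%E.
  move=> k0 zoo; apply: (@le_lt_trans _ _ (k%:E * sqnorm z)%E); last first.
    by rewrite lte_mul_pinfty// lee_fin.
  apply: ge_ereal_sup => _ [F FI <-].
  have -> : (\sum_(i \in F) (k * normc (z i) ^+ 2)%:E =
             k%:E * \sum_(i \in F) (normc (z i) ^+ 2)%:E)%E.
    rewrite ge0_mule_fsumr//.
  rewrite lee_wpmul2l ?lee_fin//.
  by apply: ereal_sup_ubound; exists F.
apply: (@le_lt_trans _ _ (\esum_(i in [set: I])
   ((c * normc (x i) ^+ 2)%:E + (2 * normc (y i) ^+ 2)%:E))%E).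
  apply: le_esum => i _; rewrite -EFinD lee_fin.
  have ncE (z : R[i]) : normc z ^+ 2 = complex.Re z ^+ 2 + complex.Im z ^+ 2.
    by case: z => u v /=; rewrite sqr_sqrtr// addr_ge0// sqr_ge0.
  have -> : (a *: x + y) i = a * x i + y i by [].
  have -> : c * normc (x i) ^+ 2 = 2 * normc (a * x i) ^+ 2.
    by rewrite /c normcM exprMn -mulrA.
  move: (a * x i) (y i) => [u1 u2] [v1 v2]; rewrite !ncE /=.
  rewrite -subr_ge0.
  have -> : 2 * (u1 ^+ 2 + u2 ^+ 2) + 2 * (v1 ^+ 2 + v2 ^+ 2) -
    ((u1 + v1) ^+ 2 + (u2 + v2) ^+ 2) = (u1 - v1) ^+ 2 + (u2 - v2) ^+ 2.
    rewrite !sqrrD !sqrrN; ring.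
  by rewrite addr_ge0 ?sqr_ge0.
rewrite esumD; [|by move=> i _; rewrite lee_fin mulr_ge0 ?sqr_ge0..].
by rewrite lte_add_pinfty// esumZ.
Qed.

HB.instance Definition _ := GRing.isSubmodClosed.Build R[i] (I -> R[i])
  square_summable square_summable_submod.

Record ell2 := Ell2 { ell2_fun :> I -> R[i]; _ : ell2_fun \in square_summable }.

HB.instance Definition _ := [isSub for ell2_fun].
HB.instance Definition _ := [Choice of ell2 by <:].
HB.instance Definition _ := [SubChoice_isSubLmodule of ell2 by <:].

Lemma ket_subproof (i : I) :
  (fun j : I => (j == i)%:R : R[i]) \in square_summable.
Proof.
rewrite inE /sqnorm.
have -> : (\esum_(j in [set: I]) (normc ((j == i)%:R : R[i]) ^+ 2)%:E =
  \esum_(j in [set i]) (1 : R)%:E)%E.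
  rewrite [RHS]esum_mkcond; apply: eq_esum => j _.
  case: eqVneq => [->|ji]; first by rewrite mem_set// normc1 expr1n.
  rewrite normc0 expr0n memNset// => /= ij; by rewrite ij eqxx in ji.
by rewrite esum_set1 ?lee_fin ?ltry.
Qed.

Definition ket (i : I) : ell2 := Ell2 (ket_subproof i).

Definition l2norm (x : ell2) : R := Num.sqrt (fine (sqnorm x)).

Definition bounded_operator (A : ell2 -> ell2) : Prop :=
  linear A /\ exists M : R, forall x, l2norm (A x) <= M * l2norm x.

(* Meaningful (a supremum of a bounded nonempty set) on bounded operators. *)
Definition opnorm (A : ell2 -> ell2) : R :=
  sup [set l2norm (A x) | x in [set x | l2norm x <= 1]].

Definition closed_operator_algebra (X : set (ell2 -> ell2)) : Prop :=
  [/\ X `<=` bounded_operator,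
      (forall (c : R[i]) A B, X A -> X B -> X (c *: A + B)),
      (forall A B, X A -> X B -> X (A \o B)) &
      (forall A, bounded_operator A ->
         (forall e : R, 0 < e -> exists2 B, X B & opnorm (A - B) < e) ->
         X A)].

End Ell2.

Arguments ell2 : clear implicits.

Section TensorAlgebra.
Context {R : realType} {T : countType}.
Implicit Types (P : T -> T -> R) (a : T -> T -> R[i]).

(* The triples (m, j, k) with (j, k) in Gr(P^m), indexing the basis. *)
Definition basis_index P : choiceType :=
  {t : nat * T * T | Gr (mpow P t.1.1) t.1.2 t.2}.

Section Components.
Variables (P : T -> T -> R) (t : basis_index P).
Definition deg : nat := (val t).1.1.
Definition tgt : T := (val t).1.2.
Definition src : T := (val t).2.
End Components.

Definition Arv P (n : nat) : set (T -> T -> R[i]) :=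
  [set a | (forall i j, ~~ Gr (mpow P n) i j -> a i j = 0) /\
    (ereal_sup [set (\esum_(i in [set: T]) (normc (a i j) ^+ 2)%:E)%E |
                j in [set: T]] < +oo)%E].

(* A is S_a^(n): the bounded operator whose value at each basis vector ket t is
   the prescribed one, given here by its coordinates: for t = (m, j, k), only
   the coordinates s = (n + m, i, k) may be nonzero. *)
Definition is_S P (n : nat) a (A : ell2 R (basis_index P) ->
                                   ell2 R (basis_index P)) : Prop :=
  bounded_operator A /\
  forall t s : basis_index P,
    A (ket t) s =
      if (deg s == n + deg t)%N && (src s == src t) then
        a (tgt s) (tgt t) *
        (real_complex R
          (Num.sqrt (mpow P n (tgt s) (tgt t) * mpow P (deg t) (tgt t) (src t)
                     / mpow P (n + deg t)%N (tgt s) (src t))))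
      else 0.

Definition tensor_algebra P :
    set (ell2 R (basis_index P) -> ell2 R (basis_index P)) :=
  smallest closed_operator_algebra
    [set A | exists n a, Arv P n a /\ is_S n a A].

End TensorAlgebra.

Arguments is_S {R T} P n a A.
Arguments tensor_algebra {R T} P _.

Definition isometric_isomorphism {R : realType} {I J : choiceType}
    (X : set (ell2 R I -> ell2 R I)) (Y : set (ell2 R J -> ell2 R J))
    (phi : (ell2 R I -> ell2 R I) -> (ell2 R J -> ell2 R J)) : Prop :=
  [/\ set_bij X Y phi,
      (forall (c : R[i]) A B, X A -> X B ->
         phi (c *: A + B) = c *: phi A + phi B),
      (forall A B, X A -> X B -> phi (A \o B) = phi A \o phi B) &
      (forall A, X A -> opnorm (phi A) = opnorm A)].

(* Main.v *)
(** Write e(n,i,j) for the operator S^(n) of the matrix unit E_ij.  These are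
    norm-one elements with e(n,i,j) e(m,j,k) = c e(n+m,i,k), where
    c^2 = P^n_ij P^m_jk / P^(n+m)_ik, so an isometric isomorphism that maps each
    e(n,i,j) to a unimodular multiple of the corresponding e(n,s i,s j) preserves
    these ratios.  All elements of the tensor algebra commute with the analogous
    right shifts, hence are determined by their values on the vacuum vectors
    (0,j,j), and are approximated by operators of bounded degree.

    Contractive idempotents are diagonal projections, and the minimal ones are
    the e(0,i,i); this gives the bijection s.  If there are at least two states,
    the isomorphism cannot lower the order of vanishing: e(1,i,j) with i != j is
    off-diagonal, and a loop e(1,i,i) has a power proportional to a power of a
    loop through some j != i.  As the image of e(n,i,j) and the image of e(n,s i,s j)
    under the inverse have order at least n, their leading coefficients are
    mutually inverse contractions, so they are unimodular, and a norm-one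
    operator leaves no room for higher terms.

    Equality of the ratios makes P^n_ij / Q^n_(s i,s j) multiplicative along
    paths, hence equal to lambda^n g(j) / g(i).  Equality of the spectral radii
    forces lambda = 1; then g is harmonic for Q and 1/g for P, so g is constant. *)

Require Import Defs.
From mathcomp Require Import all_boot all_order all_algebra.
From mathcomp Require Import all_classical all_reals all_analysis.
From mathcomp Require Import complex ring lra zify.

Set Implicit Arguments.
Unset Strict Implicit.
Unset Printing Implicit Defensive.

Import Order.TTheory GRing.Theory Num.Theory.
Import ComplexField.Normc.

Arguments normc : simpl never.

(** * Square-summable families and operators *)

(** The grading argument requires a second state. Over a single state the algebra is the disc
    algebra, whose Möbius automorphisms are isometric and may send the generator to a function with
    nonzero constant term; that case is settled directly, because a stochastic matrix of size one is
    1.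

    An element of the algebra need not be the norm limit of its Fourier series, so an isomorphism
    cannot be applied to it coefficient by coefficient. A corner element is therefore approximated
    by a finite combination of shifts, whose coefficients are close to the true ones but whose
    length is uncontrolled. When the inverse isomorphism is applied, the order bound leaves only the
    terms of degree at most n in the coefficient of degree n, so the total error does not depend on
    the length.

    The final relation g(i) P_ij = Q_(s i,s j) g(j) can be summed over j by the row sums of either
    matrix. This is why it is enough that one of them, no matter which, is strong Liouville. *)

Section NonnegativeSums.
Local Open Scope classical_set_scope.
Local Open Scope ring_scope.
Context {R : realType} {I : choiceType}.
Implicit Types (f : I -> R) (F : seq I).

Lemma esum_le_fin f (M : R) : (forall i, 0 <= f i) ->
  (forall F, uniq F -> \sum_(i <- F) f i <= M) ->
  (\esum_(i in [set: I]) (f i)%:E <= M%:E)%E.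
Proof.
move=> f0 FM; apply: ge_ereal_sup => _ [A [Afin _] <-].
move/finite_seqP : Afin => [s ->].
have -> : [set` s] = [set` undup s].
  by apply/seteqP; split => x /=; rewrite mem_undup.
rewrite -fsbig_seq ?undup_uniq// sumEFin lee_fin.
exact: FM (undup_uniq s).
Qed.

Lemma le_sum_esum f F : (forall i, 0 <= f i) -> uniq F ->
  ((\sum_(i <- F) f i)%:E <= \esum_(i in [set: I]) (f i)%:E)%E.
Proof.
move=> f0 uF; rewrite -sumEFin fsbig_seq//.
by apply: ereal_sup_ubound; exists [set` F] => //; split.
Qed.

Lemma esum_fin_approx f (M e : R) : (forall i, 0 <= f i) ->
  (\esum_(i in [set: I]) (f i)%:E = M%:E)%E -> 0 < e ->
  exists2 F, uniq F & M - e < \sum_(i <- F) f i.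
Proof.
move=> f0 fM e0; apply: contrapT => nF.
suff : (M%:E <= (M - e)%:E)%E by rewrite lee_fin lerDl oppr_ge0 leNgt e0.
rewrite -fM; apply: esum_le_fin => // F uF.
by rewrite leNgt; apply/negP => MF; apply: nF; exists F.
Qed.

End NonnegativeSums.

Section Ell2Theory.
Local Open Scope classical_set_scope.
Local Open Scope ring_scope.
Context {R : realType} {I : choiceType}.
Implicit Types (x y : ell2 R I) (F : seq I).

Lemma normc_ge0 (z : R[i]) : 0 <= normc z.
Proof. by case: z => a b; rewrite /normc sqrtr_ge0. Qed.

(* Rewriting with the generic [mulr0] in [R[i]] leaves a zero in unfolded form,
   which blocks [addr0]; these instances do not. *)
Lemma cmulr0 (z : R[i]) : z * 0 = 0. Proof. exact: mulr0. Qed.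
Lemma cmul0r (z : R[i]) : 0 * z = 0. Proof. exact: mul0r. Qed.
Lemma caddr0 (z : R[i]) : z + 0 = z. Proof. exact: addr0. Qed.
Lemma cadd0r (z : R[i]) : 0 + z = z. Proof. exact: add0r. Qed.
Lemma cmulr1 (z : R[i]) : z * 1 = z. Proof. exact: mulr1. Qed.
Lemma cmul1r (z : R[i]) : 1 * z = z. Proof. exact: mul1r. Qed.

Lemma normcE (z : R[i]) : normc z ^+ 2 = complex.Re z ^+ 2 + complex.Im z ^+ 2.
Proof. by case: z => a b; rewrite /normc sqr_sqrtr// addr_ge0// sqr_ge0. Qed.

Lemma normc_real (a : R) : normc (real_complex R a) = `|a|.
Proof. by rewrite /normc /= expr0n addr0 sqrtr_sqr. Qed.

Lemma normcD (z w : R[i]) : normc (z + w) <= normc z + normc w.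
Proof.
have -> : forall u : R[i], normc u = complex.Re `|u| by [].
have /= := ler_normD z w.
by rewrite lecE /= => /andP[].
Qed.

Lemma normc_opp (z : R[i]) : normc (- z) = normc z.
Proof. by case: z => a b; rewrite /normc /= !sqrrN. Qed.

Lemma normc_sqrD (z w : R[i]) :
  normc (z + w) ^+ 2 <= 2 * normc z ^+ 2 + 2 * normc w ^+ 2.
Proof.
case: z w => [a b] [c d]; rewrite !normcE /=.
have := sqr_ge0 (a - c); have := sqr_ge0 (b - d); rewrite !sqrrB !sqrrD; lra.
Qed.

Lemma sqnorm_fin x : sqnorm x = ((l2norm x) ^+ 2)%:E.
Proof.
have x0 : (0 <= sqnorm x)%E by apply: esum_ge0 => i _; rewrite lee_fin sqr_ge0.
have xoo : (sqnorm x < +oo)%E by case: x {x0} => f /=; rewrite inE.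
by rewrite /l2norm sqr_sqrtr ?fine_ge0// fineK// ge0_fin_numE.
Qed.

Lemma l2norm_ge0 x : 0 <= l2norm x. Proof. exact: sqrtr_ge0. Qed.

Lemma sum_le_l2 x F : uniq F -> \sum_(i <- F) normc (x i) ^+ 2 <= l2norm x ^+ 2.
Proof.
move=> uF; rewrite -lee_fin -sqnorm_fin; apply: le_sum_esum => // i.
exact: sqr_ge0.
Qed.

Lemma square_summable_bound (f : I -> R[i]) (M : R) :
  (forall F, uniq F -> \sum_(i <- F) normc (f i) ^+ 2 <= M) ->
  f \in square_summable.
Proof.
move=> FM; rewrite inE; apply: (@le_lt_trans _ _ M%:E); last exact: ltry.
by apply: esum_le_fin => // i; exact: sqr_ge0.
Qed.

Lemma l2norm_bound x (M : R) : 0 <= M ->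
  (forall F, uniq F -> \sum_(i <- F) normc (x i) ^+ 2 <= M ^+ 2) -> l2norm x <= M.
Proof.
move=> M0 FM; rewrite -(@ler_pXn2r _ 2) ?nnegrE ?l2norm_ge0//.
rewrite -lee_fin -sqnorm_fin.
by apply: esum_le_fin => // i; exact: sqr_ge0.
Qed.

Lemma l2norm_approx x (e : R) : 0 < e ->
  exists2 F, uniq F & l2norm x ^+ 2 - e < \sum_(i <- F) normc (x i) ^+ 2.
Proof.
move=> e0; apply: esum_fin_approx => //; first by move=> i; exact: sqr_ge0.
exact: sqnorm_fin.
Qed.

Lemma coord_le x i : normc (x i) <= l2norm x.
Proof.
rewrite -(@ler_pXn2r _ 2) ?nnegrE ?l2norm_ge0 ?normc_ge0//.
by have := @sum_le_l2 x [:: i] isT; rewrite big_seq1.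
Qed.

Lemma ell2P x y : x =1 y -> x = y.
Proof. by move=> xy; apply: val_inj; apply/funext. Qed.

Lemma ell2DE x y i : (x + y) i = x i + y i. Proof. by []. Qed.
Lemma ell2BE x y i : (x - y) i = x i - y i. Proof. by []. Qed.
Lemma ell2ZE (c : R[i]) x i : (c *: x) i = c * x i. Proof. by []. Qed.
Lemma ell20E i : (0 : ell2 R I) i = 0. Proof. by []. Qed.

Lemma l2norm0 : l2norm (0 : ell2 R I) = 0.
Proof.
apply/eqP; rewrite eq_le l2norm_ge0 andbT; apply: l2norm_bound => // F _.
by rewrite expr0n big1// => i _; rewrite normc0 expr0n.
Qed.

Lemma l2norm_eq0 x : l2norm x <= 0 -> x = 0.
Proof.
move=> x0; apply: ell2P => i; apply: eq0_normc; apply/eqP.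
by rewrite eq_le normc_ge0 andbT (le_trans (coord_le x i)).
Qed.

Lemma l2normZ_le (c : R[i]) x : l2norm (c *: x) <= normc c * l2norm x.
Proof.
apply: l2norm_bound => [|F uF]; first by rewrite mulr_ge0 ?normc_ge0 ?l2norm_ge0.
rewrite (eq_bigr (fun i => normc c ^+ 2 * normc (x i) ^+ 2)); last first.
  by move=> i _; rewrite ell2ZE normcM exprMn.
by rewrite -mulr_sumr exprMn ler_wpM2l ?sqr_ge0// sum_le_l2.
Qed.

(** The factor 2 comes from using the pointwise bound [normc_sqrD] in place of Minkowski's
    inequality. It is harmless for boundedness and for norm limits, and is paid for by the constant
    4 in [norm_closure_algebra]. *)
Lemma l2normD x y : l2norm (x + y) <= 2 * (l2norm x + l2norm y).
Proof.
have x0 := l2norm_ge0 x; have y0 := l2norm_ge0 y.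
apply: l2norm_bound => [|F uF]; first by rewrite mulr_ge0// addr_ge0.
apply: (@le_trans _ _ (2 * l2norm x ^+ 2 + 2 * l2norm y ^+ 2)).
  apply: (@le_trans _ _ (2 * (\sum_(i <- F) normc (x i) ^+ 2)
                       + 2 * (\sum_(i <- F) normc (y i) ^+ 2))).
    by rewrite !mulr_sumr -big_split /=; apply: ler_sum => i _; exact: normc_sqrD.
  by have := sum_le_l2 x uF; have := sum_le_l2 y uF; lra.
by have := mulr_ge0 x0 y0; nra.
Qed.

Lemma ketE (i j : I) : (ket i : ell2 R I) j = (j == i)%:R. Proof. by []. Qed.

Lemma l2norm_ket i : l2norm (ket i : ell2 R I) <= 1.
Proof.
apply: l2norm_bound => // F uF; rewrite expr1n.
rewrite (eq_bigr (fun j => (i == j)%:R)); last first.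
  move=> j _; rewrite ketE eq_sym; case: (i == j); first by rewrite normc1 expr1n.
  by rewrite normc0 expr0n.
have [iF|iF] := boolP (i \in F).
  rewrite (bigD1_seq i)//= eqxx big1 ?addr0// => j ji.
  by rewrite eq_sym (negbTE ji).
by rewrite big_seq big1// => j jF; case: eqP => // ij; rewrite ij jF in iF.
Qed.

(** One half of Pythagoras: since [x i = 0], the two summands have disjoint supports. *)
Lemma l2norm_ketD i x (a : R) : x i = 0 ->
  l2norm (ket i + real_complex R a *: x) ^+ 2 <= 1 + a ^+ 2 * l2norm x ^+ 2.
Proof.
move=> xi; have M0 : 0 <= 1 + a ^+ 2 * l2norm x ^+ 2.
  by rewrite addr_ge0// mulr_ge0 ?sqr_ge0.
rewrite -[leRHS](sqr_sqrtr M0) ler_pXn2r ?nnegrE ?l2norm_ge0 ?sqrtr_ge0//.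
apply: l2norm_bound => [|F uF]; rewrite ?sqrtr_ge0// sqr_sqrtr//.
apply: (@le_trans _ _ (\sum_(j <- F) normc ((ket i : ell2 R I) j) ^+ 2 +
   a ^+ 2 * \sum_(j <- F) normc (x j) ^+ 2)).
  rewrite mulr_sumr -big_split le_eqVlt; apply/orP; left; apply/eqP.
  apply: eq_bigr => j _; rewrite ell2DE ell2ZE ketE [RHS]/=.
  have [->|_] := eqVneq j i.
    by rewrite xi cmulr0 caddr0 normc0 expr0n mulr0 addr0.
  by rewrite cadd0r normc0 expr0n add0r normcM exprMn normc_real real_normK ?num_real.
rewrite lerD//; last by rewrite ler_wpM2l ?sqr_ge0// sum_le_l2.
rewrite (le_trans (sum_le_l2 _ uF))// -[leRHS](expr1n _ 2).
by rewrite ler_pXn2r ?nnegrE ?l2norm_ge0// l2norm_ket.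
Qed.

Lemma truncation_subproof F x :
  (fun i => if i \in F then x i else 0) \in square_summable.
Proof.
apply: (@square_summable_bound _ (l2norm x ^+ 2)) => G uG.
apply: le_trans (sum_le_l2 x uG); apply: ler_sum => i _.
by case: ifP => // _; rewrite normc0 expr0n sqr_ge0.
Qed.

Definition truncation F x : ell2 R I := Ell2 (truncation_subproof F x).

Lemma truncation_cons i F x :
  i \notin F -> truncation (i :: F) x = x i *: ket i + truncation F x.
Proof.
move=> iF; apply: ell2P => j; rewrite ell2DE ell2ZE ketE /= in_cons.
have [->|_] := eqVneq j i; first by rewrite (negbTE iF) /= cmulr1 caddr0.
by rewrite cmulr0 cadd0r.
Qed.

Lemma truncation_approx x (e : R) : 0 < e ->
  exists2 F, uniq F & l2norm (x - truncation F x) <= e.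
Proof.
move=> e0; have e20 : 0 < e ^+ 2 by rewrite exprn_gt0.
have [F uF xF] := l2norm_approx x e20; exists F => //.
apply: l2norm_bound => [|G uG]; first exact: ltW.
have -> : \sum_(i <- G) normc ((x - truncation F x) i) ^+ 2 =
          \sum_(i <- [seq i <- G | i \notin F]) normc (x i) ^+ 2.
  rewrite big_filter [RHS]big_mkcond; apply: eq_bigr => i _.
  rewrite ell2BE /=; case: (i \in F) => /=; last by rewrite subr0.
  by rewrite subrr normc0 expr0n.
have uGF : uniq ([seq i <- G | i \notin F] ++ F).
  rewrite cat_uniq filter_uniq// uF andbT /=; apply/hasPn => i iF.
  by rewrite mem_filter iF.
by have := sum_le_l2 x uGF; rewrite big_cat /=; lra.
Qed.

End Ell2Theory.

(** * Bounded operators and norm closures *)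

Section Operators.
Local Open Scope classical_set_scope.
Local Open Scope ring_scope.
Context {R : realType}.

Section Linear.
Context {I J : choiceType}.
Variable A : ell2 R I -> ell2 R J.
Hypothesis linA : linear A.

Lemma lin0 : A 0 = 0.
Proof. by have := linA (-1) 0 0; rewrite scaleN1r addNr => ->; rewrite scaleN1r addNr. Qed.
Lemma linZ c x : A (c *: x) = c *: A x.
Proof. by have := linA c x 0; rewrite lin0 !addr0. Qed.
Lemma linD x y : A (x + y) = A x + A y.
Proof. by have := linA 1 x y; rewrite !scale1r. Qed.
Lemma linB x y : A (x - y) = A x - A y.
Proof. by rewrite -[- y]scaleN1r addrC linA scaleN1r addrC. Qed.
End Linear.

Context {I : choiceType}.
Implicit Types (A B : ell2 R I -> ell2 R I) (x y : ell2 R I).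

Lemma opE A B c x : (c *: A + B) x = c *: A x + B x. Proof. by []. Qed.
Lemma opDE A B x : (A + B) x = A x + B x. Proof. by []. Qed.
Lemma opBE A B x : (A - B) x = A x - B x. Proof. by []. Qed.
Lemma opZE A c x : (c *: A) x = c *: A x. Proof. by []. Qed.

Lemma bounded_pos A : bounded_operator A ->
  exists2 M : R, 0 <= M & forall x, l2norm (A x) <= M * l2norm x.
Proof.
move=> [_ [M AM]]; exists `|M| => // x; rewrite (le_trans (AM x))//.
by rewrite ler_wpM2r ?l2norm_ge0 ?ler_norm.
Qed.

Lemma opnorm_le A x : bounded_operator A -> l2norm (A x) <= opnorm A * l2norm x.
Proof.
move=> bA; have [M M0 AM] := bounded_pos bA; have lA := bA.1.
have [x0|x0] := leP (l2norm x) 0.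
  have := AM x; have -> : l2norm x = 0 by apply/eqP; rewrite eq_le x0 l2norm_ge0.
  by rewrite !mulr0.
set y := real_complex R (l2norm x)^-1 *: x.
have xE : x = real_complex R (l2norm x) *: y.
  rewrite /y scalerA -rmorphM divff ?gt_eqF// rmorph1 scale1r//.
rewrite {1}xE linZ// (le_trans (l2normZ_le _ _))// normc_real gtr0_norm//.
rewrite mulrC ler_wpM2r ?l2norm_ge0//.
apply: ub_le_sup.
  exists M => _ [z /= z1 <-]; rewrite (le_trans (AM z))//.
  by rewrite -[leRHS]mulr1 ler_wpM2l.
exists y => //=; rewrite /y.
rewrite (le_trans (l2normZ_le _ _))// normc_real gtr0_norm ?invr_gt0//.
by rewrite mulVf ?gt_eqF.
Qed.

Lemma opnorm_bound A (M : R) : 0 <= M ->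
  (forall x, l2norm (A x) <= M * l2norm x) -> opnorm A <= M.
Proof.
move=> M0 AM; apply: ge_sup.
  by exists (l2norm (A 0)); exists 0 => //=; rewrite l2norm0.
move=> _ [x /= x1 <-]; rewrite (le_trans (AM x))//.
by rewrite -[leRHS]mulr1 ler_wpM2l.
Qed.

Lemma opnorm_ge0 A : bounded_operator A -> 0 <= opnorm A.
Proof.
move=> bA; have [M M0 AM] := bounded_pos bA.
apply: (@le_trans _ _ (l2norm (A 0))); first exact: l2norm_ge0.
apply: ub_le_sup; last by exists 0 => //=; rewrite l2norm0.
exists M => _ [y /= y1 <-]; rewrite (le_trans (AM y))//.
by rewrite -[leRHS]mulr1 ler_wpM2l.
Qed.

Lemma coord_opnorm A i j : bounded_operator A ->
  normc (A (ket i) j) <= opnorm A.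
Proof.
move=> bA; rewrite (le_trans (coord_le _ _))// (le_trans (opnorm_le _ bA))//.
by rewrite -[leRHS]mulr1 ler_wpM2l ?opnorm_ge0// l2norm_ket.
Qed.

Lemma bounded_lin c A B : bounded_operator A -> bounded_operator B ->
  bounded_operator (c *: A + B).
Proof.
move=> bA bB; split.
  move=> a x y; rewrite !opE bA.1 bB.1 !scalerDr !scalerA (mulrC c).
  by rewrite addrACA.
have [M M0 AM] := bounded_pos bA; have [N N0 BN] := bounded_pos bB.
exists (2 * (normc c * M + N)) => x; rewrite opE (le_trans (l2normD _ _))//.
rewrite -mulrA ler_wpM2l// mulrDl lerD// (le_trans (l2normZ_le _ _))//.
by rewrite -mulrA ler_wpM2l ?normc_ge0.
Qed.

Lemma bounded_comp A B : bounded_operator A -> bounded_operator B ->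
  bounded_operator (A \o B).
Proof.
move=> bA bB; split=> [a x y|]; first by rewrite /= bB.1 bA.1.
have [M M0 AM] := bounded_pos bA; have [N N0 BN] := bounded_pos bB.
exists (M * N) => x /=; rewrite (le_trans (AM _))//.
by rewrite -mulrA ler_wpM2l.
Qed.

Lemma bounded0 : bounded_operator (0 : ell2 R I -> ell2 R I).
Proof.
split=> [a x y|]; first by rewrite /= scaler0 addr0.
by exists 0 => x; rewrite mul0r l2norm0.
Qed.

Lemma subE A B : A - B = (-1) *: B + A.
Proof. by rewrite scaleN1r addrC. Qed.

Lemma bounded_sub A B : bounded_operator A -> bounded_operator B ->
  bounded_operator (A - B).
Proof. by rewrite subE => bA bB; exact: bounded_lin. Qed.

(** Linearity settles the finite truncations of [x], in which each ket either lies in [D] or has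
    coefficient zero; boundedness then passes to the limit. This is how every statement about kets
    is extended to vectors. *)
Lemma coord0_of_ket {J : choiceType} (A : ell2 R I -> ell2 R J) (M : R) (D : pred I) x s :
  linear A -> (forall x, l2norm (A x) <= M * l2norm x) ->
  (forall t, D t -> A (ket t) s = 0) ->
  (forall t, ~~ D t -> x t = 0) -> A x s = 0.
Proof.
move=> lA AM As xD; have trunc0 F : uniq F -> A (truncation F x) s = 0.
  elim: F => [_|t F IH /= /andP[tF uF]].
    by have -> : truncation [::] x = 0 by [apply: ell2P]; rewrite (lin0 lA).
  rewrite truncation_cons// lA ell2DE ell2ZE IH// addr0.
  by have [/As->|/xD->] := boolP (D t); rewrite ?cmulr0 ?cmul0r.
apply: eq0_normc; apply/eqP; rewrite eq_le normc_ge0 andbT.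
apply/ler_addgt0Pr => e e0; rewrite add0r.
(* [M] may have any sign; [|M| + 1] is a positive bound by which [e] can be divided. *)
have M1 : 0 < `|M| + 1 by rewrite ltr_pwDr.
have [F uF xF] := truncation_approx x (divr_gt0 e0 M1).
rewrite -[x](subrK (truncation F x)) (linD lA) ell2DE trunc0// addr0.
rewrite (le_trans (coord_le _ _))// (le_trans (AM _))//.
rewrite -[leRHS](divfK (lt0r_neq0 M1)) [leRHS]mulrC.
apply: (@le_trans _ _ ((`|M| + 1) * l2norm (x - truncation F x))).
  rewrite ler_wpM2r ?l2norm_ge0// (le_trans (ler_norm _))// lerDl//.
by rewrite ler_wpM2l// ltW.
Qed.

Lemma eq_on_kets A B : bounded_operator A -> bounded_operator B ->
  (forall t, A (ket t) = B (ket t)) -> A = B.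
Proof.
move=> bA bB AB; apply/funext => x; apply: ell2P => s.
apply/eqP; rewrite -subr_eq0; apply/eqP.
have [lAB [M ABM]] := bounded_sub bA bB.
apply: (@coord0_of_ket _ (A - B) M predT x s lAB ABM) => // t _.
by rewrite opBE AB subrr.
Qed.

Definition norm_closure (X : set (ell2 R I -> ell2 R I)) :=
  [set A | bounded_operator A /\
    forall e : R, 0 < e -> exists2 B, X B & opnorm (A - B) < e].

Lemma opnormD A B : bounded_operator A -> bounded_operator B ->
  opnorm (A + B) <= 2 * (opnorm A + opnorm B).
Proof.
move=> bA bB; apply: opnorm_bound => [|x].
  by rewrite mulr_ge0 ?addr_ge0 ?opnorm_ge0.
rewrite opDE (le_trans (l2normD _ _))// -mulrA ler_wpM2l// mulrDl.
by rewrite lerD ?opnorm_le.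
Qed.

Lemma opnormM A B : bounded_operator A -> bounded_operator B ->
  opnorm (A \o B) <= opnorm A * opnorm B.
Proof.
move=> bA bB; apply: opnorm_bound => [|x]; first by rewrite mulr_ge0 ?opnorm_ge0.
rewrite (le_trans (opnorm_le _ bA))// -mulrA ler_wpM2l ?opnorm_ge0//.
exact: opnorm_le.
Qed.

Lemma bounded_scale c A : bounded_operator A -> bounded_operator (c *: A).
Proof. by rewrite -[c *: A]addr0 => bA; apply: bounded_lin => //; exact: bounded0. Qed.

Lemma opnormZ_le c A : bounded_operator A -> opnorm (c *: A) <= normc c * opnorm A.
Proof.
move=> bA; apply: opnorm_bound => [|x]; first by rewrite mulr_ge0 ?opnorm_ge0 ?normc_ge0.
rewrite opZE (le_trans (l2normZ_le _ _))// -mulrA ler_wpM2l ?normc_ge0//.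
exact: opnorm_le.
Qed.

Lemma norm_closure_algebra (X : set (ell2 R I -> ell2 R I)) :
  X `<=` bounded_operator ->
  (forall (c : R[i]) A B, X A -> X B -> X (c *: A + B)) ->
  (forall A B, X A -> X B -> X (A \o B)) ->
  closed_operator_algebra (norm_closure X).
Proof.
move=> Xb Xl Xc; split.
- by move=> A [].
- move=> c A B [bA XA] [bB XB]; split; first exact: bounded_lin.
  move=> e e0.
  have c1 : 0 < normc c + 1 by rewrite ltr_wpDl ?normc_ge0.
  (* The 4 covers two error terms and the factor 2 of [opnormD]; the added 1 keeps the divisor
     positive. *)
  have dA : 0 < e / 4 / (normc c + 1) by rewrite !divr_gt0.
  have dB : 0 < e / 4 by rewrite divr_gt0.
  have [A' XA' AA'] := XA _ dA; have [B' XB' BB'] := XB _ dB.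
  exists (c *: A' + B'); first exact: Xl.
  have -> : c *: A + B - (c *: A' + B') = c *: (A - A') + (B - B').
    by rewrite scalerBr opprD addrACA.
  have bAA := bounded_sub bA (Xb _ XA'); have bBB := bounded_sub bB (Xb _ XB').
  rewrite (le_lt_trans (opnormD (bounded_scale c bAA) bBB))//.
  have := opnormZ_le c bAA; have := opnorm_ge0 bAA.
  move: AA' BB'; rewrite ltr_pdivlMr//.
  by have := normc_ge0 c; nra.
- move=> A B [bA XA] [bB XB]; split; first exact: bounded_comp.
  move=> e e0.
  have A1 : 0 < opnorm A + 1 by rewrite ltr_wpDl ?opnorm_ge0.
  have dB : 0 < e / 4 / (opnorm A + 1) by rewrite !divr_gt0.
  (* [B'] is fixed first: in the splitting [A (B - B') + (A - A') B'] the tolerance for [A'] depends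
     on the norm of [B']. *)
  have [B' XB' BB'] := XB _ dB; have bB' := Xb _ XB'.
  have B1 : 0 < opnorm B' + 1 by rewrite ltr_wpDl ?opnorm_ge0.
  have dA : 0 < e / 4 / (opnorm B' + 1) by rewrite !divr_gt0.
  have [A' XA' AA'] := XA _ dA; have bA' := Xb _ XA'.
  exists (A' \o B'); first exact: Xc.
  have -> : (A \o B) - (A' \o B') = (A \o (B - B')) + ((A - A') \o B').
    apply/funext => x; rewrite opBE opDE /= !opBE (linB bA.1).
    by rewrite addrA subrK.
  have bAA := bounded_sub bA bA'; have bBB := bounded_sub bB bB'.
  rewrite (le_lt_trans (opnormD (bounded_comp bA bBB) (bounded_comp bAA bB')))//.
  have := opnormM bA bBB; have := opnormM bAA bB'.
  have := opnorm_ge0 bAA; have := opnorm_ge0 bBB.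
  have := opnorm_ge0 bA; have := opnorm_ge0 bB'.
  by move: AA' BB'; rewrite !ltr_pdivlMr//; nra.
- move=> A bA XA; split=> // e e0.
  have d0 : 0 < e / 4 by rewrite divr_gt0.
  have [B [bB XB] AB] := XA _ d0; have [C XC BC] := XB _ d0.
  exists C => //; have -> : A - C = (A - B) + (B - C) by rewrite addrA subrK.
  have bAB := bounded_sub bA bB; have bBC := bounded_sub bB (Xb _ XC).
  by rewrite (le_lt_trans (opnormD bAB bBC))//; lra.
Qed.

End Operators.
(** * Powers of stochastic matrices *)

Section StochasticPowers.
Local Open Scope classical_set_scope.
Local Open Scope ring_scope.
Context {R : realType} {T : countType}.
Variable P : T -> T -> R.
Hypothesis stoP : stochastic P.

Lemma stoch_sum_le1 i F : uniq F -> \sum_(k <- F) P i k <= 1.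
Proof.
move=> uF; rewrite -lee_fin -(stoP.2 i); apply: le_sum_esum => // k.
by have /andP[] := stoP.1 i k.
Qed.

Lemma stoch_ge0 i j : 0 <= P i j. Proof. by have /andP[] := stoP.1 i j. Qed.

(** The upper bound is what makes the sum under [fine] finite, so the bounds come by induction first
    and [mpowS] can remove [fine] afterwards. *)
Lemma mpow_bounds n i j : 0 <= mpow P n i j <= 1.
Proof.
elim: n i j => [|n IH] i j /=; first by case: (i == j); rewrite ?lexx ?ler01.
have t0 k : 0 <= P i k * mpow P n k j.
  by have /andP[? _] := IH k j; rewrite mulr_ge0 ?stoch_ge0.
have s0 : (0 <= \esum_(k in [set: T]) (P i k * mpow P n k j)%:E)%E.
  by apply: esum_ge0 => k _; rewrite lee_fin.
have s1 : (\esum_(k in [set: T]) (P i k * mpow P n k j)%:E <= 1%:E)%E.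
  apply: esum_le_fin => // F uF; apply: le_trans (stoch_sum_le1 i uF).
  apply: ler_sum => k _; rewrite -[leRHS]mulr1.
  by have /andP[_ ?] := IH k j; rewrite ler_wpM2l ?stoch_ge0.
have sf : (\esum_(k in [set: T]) (P i k * mpow P n k j)%:E)%E \is a fin_num.
  by rewrite ge0_fin_numE// (le_lt_trans s1)// ltry.
by rewrite fine_ge0//= -lee_fin fineK.
Qed.

Lemma mpow_ge0 n i j : 0 <= mpow P n i j.
Proof. by have /andP[] := mpow_bounds n i j. Qed.

Lemma mpow_le1 n i j : mpow P n i j <= 1.
Proof. by have /andP[] := mpow_bounds n i j. Qed.

Lemma mpow_term_ge0 n i j k : 0 <= P i k * mpow P n k j.
Proof. by rewrite mulr_ge0 ?stoch_ge0 ?mpow_ge0. Qed.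

Lemma mpowS n i j :
  (\esum_(k in [set: T]) (P i k * mpow P n k j)%:E = (mpow P n.+1 i j)%:E)%E.
Proof.
have s0 : (0 <= \esum_(k in [set: T]) (P i k * mpow P n k j)%:E)%E.
  by apply: esum_ge0 => k _; rewrite lee_fin mpow_term_ge0.
have s1 : (\esum_(k in [set: T]) (P i k * mpow P n k j)%:E <= 1%:E)%E.
  apply: esum_le_fin => // [k|F uF]; first exact: mpow_term_ge0.
  apply: le_trans (stoch_sum_le1 i uF).
  apply: ler_sum => k _; rewrite -[leRHS]mulr1.
  by rewrite ler_wpM2l ?stoch_ge0 ?mpow_le1.
by rewrite /= fineK// ge0_fin_numE// (le_lt_trans s1)// ltry.
Qed.

Lemma mpow_sum_le n i j F : uniq F ->
  \sum_(k <- F) P i k * mpow P n k j <= mpow P n.+1 i j.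
Proof.
move=> uF; rewrite -lee_fin -mpowS; apply: le_sum_esum => // k.
exact: mpow_term_ge0.
Qed.

Lemma mpow_leS n i j (M : R) :
  (forall F, uniq F -> \sum_(k <- F) P i k * mpow P n k j <= M) ->
  mpow P n.+1 i j <= M.
Proof.
by move=> FM; rewrite -lee_fin -mpowS; apply: esum_le_fin => // k; exact: mpow_term_ge0.
Qed.

(** One intermediate state of the Chapman-Kolmogorov sum. It makes the shift weights contractive and
    the supports multiplicative. *)
Lemma mpow_mul_le n m i j k :
  mpow P n i j * mpow P m j k <= mpow P (n + m) i k.
Proof.
elim: n i => [|n IH] i.
  rewrite [mpow P 0 _ _]/= add0n; have [->|_] := eqVneq i j; first by rewrite mul1r.
  by rewrite mul0r mpow_ge0.
have [c0|c0] := leP (mpow P m j k) 0.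
  have -> : mpow P m j k = 0 by apply/eqP; rewrite eq_le c0 mpow_ge0.
  by rewrite mulr0 mpow_ge0.
rewrite -ler_pdivlMr//; apply: mpow_leS => F uF.
rewrite ler_pdivlMr// mulr_suml addSn; apply: le_trans (mpow_sum_le _ _ _ uF).
by apply: ler_sum => l _; rewrite -mulrA ler_wpM2l ?stoch_ge0.
Qed.

Lemma mpow1 i j : mpow P 1 i j = P i j.
Proof.
apply/eqP; rewrite eq_le; apply/andP; split.
  apply: mpow_leS => F uF /=; have [jF|jF] := boolP (j \in F).
    rewrite (bigD1_seq j)//= eqxx mulr1 big1 ?addr0// => k /negbTE->.
    by rewrite mulr0.
  rewrite big_seq big1 ?stoch_ge0// => k kF; case: eqP => [kj|_].
    by rewrite -kj kF in jF.
  by rewrite mulr0.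
have := @mpow_sum_le 0 i j [:: j] isT.
by rewrite big_seq1 /= eqxx mulr1.
Qed.

Lemma Gr_mpow_step n i j : Gr (mpow P n.+1) i j ->
  exists k, Gr (mpow P 1) i k /\ Gr (mpow P n) k j.
Proof.
move=> Pij; apply: contrapT => nk; move: Pij; apply/negP; rewrite -leNgt.
apply: mpow_leS => F _; rewrite big1// => k _.
have [//|t0] := eqVneq (P i k * mpow P n k j) 0.
exfalso; apply: nk; exists k; rewrite /Gr mpow1.
rewrite !lt0r stoch_ge0 mpow_ge0 !andbT.
by move: t0; rewrite mulf_eq0 negb_or => /andP[].
Qed.

Lemma Gr_mpow_mul n m i j k :
  Gr (mpow P n) i j -> Gr (mpow P m) j k -> Gr (mpow P (n + m)) i k.
Proof.
by move=> ij jk; apply: lt_le_trans (mpow_mul_le _ _ _ j _); exact: mulr_gt0.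
Qed.

Lemma Gr_mpow0 i : Gr (mpow P 0) i i. Proof. by rewrite /Gr /= eqxx. Qed.

Lemma irr_mpow i j : irreducible P -> exists n, Gr (mpow P n) i j.
Proof.
move=> /(_ i j) [s [ps <-]]; elim: s i ps => [|k s IH] i /=.
  by move=> _; exists 0%N; exact: Gr_mpow0.
move=> /andP[ik /IH[n nk]]; exists n.+1; rewrite -add1n.
by apply: Gr_mpow_mul nk; rewrite /Gr mpow1.
Qed.

(** [irreducible] admits the empty path when [i] is [j]. A first edge out of [i], which exists
    because the row sums to 1, makes the length positive. *)
Lemma irr_mpow_pos i j : irreducible P -> exists n, Gr (mpow P n.+1) i j.
Proof.
move=> irrP; have [k ik] : exists k, Gr P i k.
  apply: contrapT => nk; have : (1%:E <= 0%:E :> \bar R)%E.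
    rewrite -[leLHS](stoP.2 i); apply: esum_le_fin => [k|F _]; first exact: stoch_ge0.
    rewrite big1// => k _; apply/eqP; rewrite eq_le stoch_ge0 andbT leNgt.
    by apply/negP => ?; apply: nk; exists k.
  by rewrite lee_fin ler10.
have [n nkj] := irr_mpow k j irrP; exists n; rewrite -add1n.
by apply: Gr_mpow_mul nkj; rewrite /Gr mpow1.
Qed.

End StochasticPowers.

(** * Weighted shifts along partial injections *)

Section WeightedShifts.
Local Open Scope classical_set_scope.
Local Open Scope ring_scope.
Context {R : realType} {I J : choiceType}.
Implicit Types (w : J -> I -> R[i]) (p : J -> option I) (x : ell2 R I).

(** The shift of indices is encoded backwards: [p] sends an output index to the at most one input
    index that it reads. Each output coordinate is then a single term instead of a sum. *)
Definition wshift_fun w p (x : I -> R[i]) (s : J) : R[i] :=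
  if p s is Some t then w s t * x t else 0.

Definition contractive_weights w p :=
  (forall s s' t, p s = Some t -> p s' = Some t -> s = s') /\
  (forall s t, p s = Some t -> normc (w s t) <= 1).

Lemma wshift_sum_le w p x F : contractive_weights w p -> uniq F ->
  \sum_(s <- F) normc (wshift_fun w p x s) ^+ 2 <= l2norm x ^+ 2.
Proof.
(* [G] lists the inputs read by the outputs in [F]; injectivity of [p] keeps it free of
   duplicates. *)
move=> [pinj w1] uF; pose G := pmap p F.
have uG : uniq G.
  rewrite /G; elim: F uF {G} => [//|s F IH] /= /andP[sF uF].
  case ps : (p s) => [t|] /=; last exact: IH.
  rewrite IH// andbT; apply: contra sF; rewrite mem_pmap => /mapP[s' s'F].
  by move=> ps'; rewrite (pinj s s' t).
apply: le_trans (sum_le_l2 x uG); rewrite {uG}/G {G}.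
elim: F uF => [|s F IH] /=; first by rewrite !big_nil.
move=> /andP[_ uF]; rewrite big_cons /wshift_fun; case ps : (p s) => [t|] /=.
  rewrite big_cons lerD ?IH// normcM exprMn -[leRHS]mul1r ler_wpM2r ?sqr_ge0//.
  by rewrite expr_le1 ?normc_ge0 ?(w1 _ _ ps).
by rewrite normc0 expr0n add0r IH.
Qed.

(* Zero if the weighted family is not square summable, which cannot happen for
   contractive weights. *)
Definition wshift w p x : ell2 R J := insubd (0 : ell2 R J) (wshift_fun w p x).

Variables (w : J -> I -> R[i]) (p : J -> option I).
Hypothesis wp : contractive_weights w p.

Lemma wshiftE x s : wshift w p x s = wshift_fun w p x s.
Proof.
rewrite /wshift -[LHS]/(val (insubd _ _) s) val_insubd.
suff -> : wshift_fun w p x \in square_summable by [].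
by apply: square_summable_bound => F uF; exact: wshift_sum_le.
Qed.

Lemma wshift_linear : linear (wshift w p).
Proof.
move=> c x y; apply: ell2P => s; rewrite ell2DE ell2ZE !wshiftE /wshift_fun.
case: (p s) => [t|]; first by rewrite ell2DE ell2ZE mulrDr mulrCA.
by rewrite cmulr0 caddr0.
Qed.

Lemma wshift_norm x : l2norm (wshift w p x) <= l2norm x.
Proof.
apply: l2norm_bound => [|F uF]; first exact: l2norm_ge0.
under eq_bigr do rewrite wshiftE.
exact: wshift_sum_le.
Qed.

Lemma wshift_ketE t s :
  wshift w p (ket t) s = if p s == Some t then w s t else 0.
Proof.
rewrite wshiftE /wshift_fun; case: (p s) => [t'|]; last by [].
rewrite ketE (_ : (Some t' == Some t) = (t' == t))//; have [->|_] := eqVneq t' t; first exact: cmulr1.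
exact: cmulr0.
Qed.

End WeightedShifts.

Lemma wshift_bounded {R : realType} {I : choiceType}
    (w : I -> I -> R[i]) (p : I -> option I) :
  contractive_weights w p -> bounded_operator (wshift w p).
Proof.
move=> wp; split; first exact: wshift_linear.
by exists 1%R => x; rewrite mul1r; exact: wshift_norm.
Qed.
(** * Left and right shifts *)

Section BasisIndices.
Local Open Scope classical_set_scope.
Local Open Scope ring_scope.
Context {R : realType} {T : countType}.
Variable P : T -> T -> R.
Local Notation B := (basis_index P).
Implicit Types (s t : B).

Definition mkidx (n : nat) (i j : T) : option B :=
  (insub (n, i, j) : option {t : nat * T * T | Gr (mpow P t.1.1) t.1.2 t.2}).

Lemma idxP (s t : B) : deg s = deg t -> tgt s = tgt t -> src s = src t -> s = t.
Proof.
move=> d tg sr; apply: val_inj; move: d tg sr; rewrite /deg /tgt /src.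
by case: (val s) (val t) => [[n i] j] [[m k] l] /= -> -> ->.
Qed.

Lemma Gr_idx (s : B) : Gr (mpow P (deg s)) (tgt s) (src s).
Proof. exact: (valP s). Qed.

Lemma mkidx_def (s : B) : mkidx (deg s) (tgt s) (src s) = Some s.
Proof.
rewrite /mkidx /deg /tgt /src -!surjective_pairing.
exact: (@valK _ _ {t : nat * T * T | Gr (mpow P t.1.1) t.1.2 t.2}).
Qed.

Lemma mkidxP n i j s : mkidx n i j = Some s <->
  [/\ deg s = n, tgt s = i & src s = j].
Proof.
split=> [|[<- <- <-]]; last exact: mkidx_def.
rewrite /mkidx; case: insubP => // u _ uE [<-].
by rewrite /deg /tgt /src uE.
Qed.

Lemma mkidx_Gr n i j : Gr (mpow P n) i j ->
  exists s, [/\ deg s = n, tgt s = i & src s = j].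
Proof.
move=> ij; have: mkidx n i j != None by rewrite /mkidx insubT.
by case E : (mkidx n i j) => [s|//] _; exists s; apply/mkidxP.
Qed.

Lemma vac_subproof j :
  (fun t : nat * T * T => Gr (mpow P t.1.1) t.1.2 t.2) (0%N, j, j).
Proof. by rewrite /Gr /= eqxx. Qed.

Definition vac j : B := exist _ (0%N, j, j) (vac_subproof j).

Lemma deg_vac j : deg (vac j) = 0%N. Proof. by []. Qed.
Lemma tgt_vac j : tgt (vac j) = j. Proof. by []. Qed.
Lemma src_vac j : src (vac j) = j. Proof. by []. Qed.

Lemma deg0_vac (s : B) : deg s = 0%N -> s = vac (src s).
Proof.
move=> s0; apply: idxP; rewrite ?deg_vac ?tgt_vac ?src_vac//.
by have := Gr_idx s; rewrite s0 /Gr /=; case: eqP => // _; rewrite ltxx.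
Qed.

(** On the rescaled vectors [ket s] divided by [amp s], a shift has the constant weight
    sqrt(P^n_ij). This is why amplitudes cancel in compositions and why left and right shifts
    commute. *)
Definition amp (s : B) : R := Num.sqrt (mpow P (deg s) (tgt s) (src s)).

Lemma amp_gt0 s : 0 < amp s. Proof. by rewrite sqrtr_gt0; exact: Gr_idx. Qed.

Lemma amp_neq0 s : amp s != 0. Proof. by rewrite gt_eqF ?amp_gt0. Qed.

Lemma amp_vac j : amp (vac j) = 1.
Proof. by rewrite /amp deg_vac tgt_vac src_vac /= eqxx sqrtr1. Qed.

End BasisIndices.

Arguments mkidx {R T} P n i j.
Arguments vac {R T} P j.

Section LeftRightShifts.
Local Open Scope classical_set_scope.
Local Open Scope ring_scope.
Context {R : realType} {T : countType}.
Variable P : T -> T -> R.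
Hypothesis stoP : stochastic P.
Local Notation B := (basis_index P).
Local Notation rc := (real_complex R).
Implicit Types (s t u : B) (x y : ell2 R B).

Definition shift_weight (n : nat) (i j : T) s t : R[i] :=
  rc (Num.sqrt (mpow P n i j) * amp t / amp s).

(** The test [n <= deg s] guards the truncated subtraction. Membership of (i, j) in the graph of P^n
    is left to [shift_weight], which vanishes otherwise. *)
Definition lptr n i j s : option B :=
  if (tgt s == i) && (n <= deg s)%N then mkidx P (deg s - n) j (src s) else None.

Definition rptr n i j s : option B :=
  if (src s == j) && (n <= deg s)%N then mkidx P (deg s - n) (tgt s) i else None.

(* [lcreate n i j] is S^(n) of a matrix unit; [rcreate n i j] multiplies on the
   source side instead and commutes with every S_A. *)
Definition lcreate n i j := wshift (shift_weight n i j) (lptr n i j).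
Definition rcreate n i j := wshift (shift_weight n i j) (rptr n i j).

Lemma lptrP n i j s t : lptr n i j s = Some t <->
  [/\ deg s = (n + deg t)%N, tgt s = i, tgt t = j & src s = src t].
Proof.
rewrite /lptr; split.
  case: eqP => //= <-; case: leqP => // ns /mkidxP[-> -> ->]; split=> //.
  by rewrite subnKC.
move=> [sE -> tE ->]; rewrite eqxx sE leq_addr addKn -tE; exact: mkidx_def.
Qed.

Lemma rptrP n i j s t : rptr n i j s = Some t <->
  [/\ deg s = (n + deg t)%N, tgt s = tgt t, src t = i & src s = j].
Proof.
rewrite /rptr; split.
  case: eqP => //= <-; case: leqP => // ns /mkidxP[-> -> ->]; split=> //.
  by rewrite subnKC.
move=> [sE -> tE ->]; rewrite eqxx sE leq_addr addKn -tE; exact: mkidx_def.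
Qed.

Lemma lptrE n i j s t : (lptr n i j s == Some t) =
  [&& deg s == (n + deg t)%N, tgt s == i, tgt t == j & src s == src t].
Proof.
apply/eqP/idP => [/lptrP[-> -> -> ->]|/and4P[/eqP ? /eqP ? /eqP ? /eqP ?]].
  by rewrite !eqxx.
exact/lptrP.
Qed.

Lemma rptrE n i j s t : (rptr n i j s == Some t) =
  [&& deg s == (n + deg t)%N, tgt s == tgt t, src t == i & src s == j].
Proof.
apply/eqP/idP => [/rptrP[-> -> -> ->]|/and4P[/eqP ? /eqP ? /eqP ? /eqP ?]].
  by rewrite !eqxx.
exact/rptrP.
Qed.

(** The squared weight is P^n_ij P^m_jk / P^(n+m)_ik, which [mpow_mul_le] bounds by 1. *)
Lemma lcreate_contractive n i j : contractive_weights (shift_weight n i j) (lptr n i j).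
Proof.
split=> [s s' t /lptrP[sd st tt ss] /lptrP[sd' st' tt' ss']|s t].
  by apply: idxP; rewrite ?sd ?sd' ?st ?st' ?ss ?ss'.
move=> /lptrP[sd st tt ss]; rewrite /shift_weight normc_real ger0_norm; last first.
  by rewrite !mulr_ge0 ?invr_ge0 ?sqrtr_ge0.
rewrite ler_pdivrMr ?amp_gt0// mul1r /amp -sqrtrM ?mpow_ge0// ler_wsqrtr//.
by rewrite sd st ss tt mpow_mul_le.
Qed.

Lemma rcreate_contractive n i j : contractive_weights (shift_weight n i j) (rptr n i j).
Proof.
split=> [s s' t /rptrP[sd st tt ss] /rptrP[sd' st' tt' ss']|s t].
  by apply: idxP; rewrite ?sd ?sd' ?st ?st' ?ss ?ss'.
move=> /rptrP[sd st tt ss]; rewrite /shift_weight normc_real ger0_norm; last first.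
  by rewrite !mulr_ge0 ?invr_ge0 ?sqrtr_ge0.
rewrite ler_pdivrMr ?amp_gt0// mul1r mulrC /amp -sqrtrM ?mpow_ge0// ler_wsqrtr//.
by rewrite sd st ss tt addnC mpow_mul_le.
Qed.

Lemma lcreate_bounded n i j : bounded_operator (lcreate n i j).
Proof. exact/wshift_bounded/lcreate_contractive. Qed.

Lemma lcreate_norm n i j x : l2norm (lcreate n i j x) <= l2norm x.
Proof. exact/wshift_norm/lcreate_contractive. Qed.

Lemma rcreate_bounded n i j : bounded_operator (rcreate n i j).
Proof. exact/wshift_bounded/rcreate_contractive. Qed.

Lemma rcreate_norm n i j x : l2norm (rcreate n i j x) <= l2norm x.
Proof. exact/wshift_norm/rcreate_contractive. Qed.

Lemma lcreate_ket n i j t : Gr (mpow P n) i j -> tgt t = j ->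
  exists s, [/\ deg s = (n + deg t)%N, tgt s = i, src s = src t &
    lcreate n i j (ket t) = shift_weight n i j s t *: ket s].
Proof.
move=> ij tj; have [s [sd st ss]] : exists s : B,
    [/\ deg s = (n + deg t)%N, tgt s = i & src s = src t].
  apply: mkidx_Gr; apply: (Gr_mpow_mul stoP ij); rewrite -tj; exact: Gr_idx.
exists s; split=> //; apply: ell2P => u.
rewrite (wshift_ketE (lcreate_contractive _ _ _)) ell2ZE ketE lptrE.
have [->|us] := eqVneq u s; first by rewrite sd st ss tj !eqxx cmulr1.
rewrite cmulr0; case: ifP => // /and4P[/eqP ud /eqP ut _ /eqP us'].
by rewrite (_ : u = s) ?eqxx// in us; apply: idxP; rewrite ?ud ?ut ?us'.
Qed.

Lemma rcreate_ket n i j t : Gr (mpow P n) i j -> src t = i ->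
  exists s, [/\ deg s = (n + deg t)%N, tgt s = tgt t, src s = j &
    rcreate n i j (ket t) = shift_weight n i j s t *: ket s].
Proof.
move=> ij tj; have [s [sd st ss]] : exists s : B,
    [/\ deg s = (n + deg t)%N, tgt s = tgt t & src s = j].
  by apply: mkidx_Gr; rewrite addnC; apply: (Gr_mpow_mul stoP _ ij); rewrite -tj; exact: Gr_idx.
exists s; split=> //; apply: ell2P => u.
rewrite (wshift_ketE (rcreate_contractive _ _ _)) ell2ZE ketE rptrE.
have [->|us] := eqVneq u s; first by rewrite sd st ss tj !eqxx cmulr1.
rewrite cmulr0; case: ifP => // /and4P[/eqP ud /eqP ut _ /eqP us'].
by rewrite (_ : u = s) ?eqxx// in us; apply: idxP; rewrite ?ud ?ut ?us'.
Qed.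

Lemma lcreate_ket0 n i j t : tgt t != j -> lcreate n i j (ket t) = 0.
Proof.
move=> tj; apply: ell2P => u.
by rewrite (wshift_ketE (lcreate_contractive _ _ _)) lptrE (negbTE tj) !andbF.
Qed.

Lemma rcreate_ket0 n i j t : src t != i -> rcreate n i j (ket t) = 0.
Proof.
move=> tj; apply: ell2P => u.
by rewrite (wshift_ketE (rcreate_contractive _ _ _)) rptrE (negbTE tj) !andbF.
Qed.

Lemma shift_weight0 n i j s t : ~~ Gr (mpow P n) i j -> shift_weight n i j s t = 0.
Proof.
rewrite /Gr -leNgt => /ler0_sqrtr ij.
by rewrite /shift_weight ij !mul0r rmorph0.
Qed.

Lemma lcreate_eq0 n i j x : ~~ Gr (mpow P n) i j -> lcreate n i j x = 0.
Proof.
move=> nij; apply: ell2P => s.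
rewrite (wshiftE (lcreate_contractive _ _ _)) /wshift_fun.
by case: (lptr n i j s) => // t; rewrite shift_weight0 ?cmul0r.
Qed.

Lemma rcreate_eq0 n i j x : ~~ Gr (mpow P n) i j -> rcreate n i j x = 0.
Proof.
move=> nij; apply: ell2P => s.
rewrite (wshiftE (rcreate_contractive _ _ _)) /wshift_fun.
by case: (rptr n i j s) => // t; rewrite shift_weight0 ?cmul0r.
Qed.

Lemma rcreate_vac t : rcreate (deg t) (tgt t) (src t) (ket (vac P (tgt t))) = ket t.
Proof.
have [s [sd st ss ->]] := rcreate_ket (Gr_idx t) (src_vac P (tgt t)).
have -> : s = t by apply: idxP; rewrite ?sd ?st ?ss ?addn0.
by rewrite /shift_weight amp_vac mulr1 divff ?amp_neq0// rmorph1 scale1r.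
Qed.

Lemma lcreate_vac n i j : Gr (mpow P n) i j ->
  exists s, [/\ deg s = n, tgt s = i, src s = j & lcreate n i j (ket (vac P j)) = ket s].
Proof.
move=> ij; have [s [sd st ss ->]] := lcreate_ket ij (tgt_vac P j).
exists s; split; rewrite ?sd ?addn0//.
suff -> : shift_weight n i j s (vac P j) = 1 by rewrite scale1r.
rewrite /shift_weight amp_vac mulr1 /amp sd st ss addn0.
by rewrite divff ?rmorph1// gt_eqF// sqrtr_gt0.
Qed.

Definition rcomm (A : ell2 R B -> ell2 R B) : Prop :=
  forall l i j x, A (rcreate l i j x) = rcreate l i j (A x).

Definition low_degree n x := forall s, (deg s < n)%N -> x s = 0.
Definition high_degree n x := forall s, (n < deg s)%N -> x s = 0.

Lemma rcomm_ket A t : rcomm A ->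
  A (ket t) = rcreate (deg t) (tgt t) (src t) (A (ket (vac P (tgt t)))).
Proof. by move=> rA; rewrite -rA rcreate_vac. Qed.

Lemma rcomm_eq A A' : bounded_operator A -> rcomm A ->
  bounded_operator A' -> rcomm A' ->
  (forall j, A (ket (vac P j)) = A' (ket (vac P j))) -> A = A'.
Proof.
move=> bA rA bA' rA' AA'; apply: eq_on_kets => // t.
by rewrite rcomm_ket// AA' -rcomm_ket.
Qed.

Lemma rcreateE n i j x s : rcreate n i j x s =
  if rptr n i j s is Some t then shift_weight n i j s t * x t else 0.
Proof. exact/wshiftE/rcreate_contractive. Qed.

Lemma lcreateE n i j x s : lcreate n i j x s =
  if lptr n i j s is Some t then shift_weight n i j s t * x t else 0.
Proof. exact/wshiftE/lcreate_contractive. Qed.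

(** By [rcomm_ket], [A (ket t)] is a right shift by [deg t] of a vacuum value of [A], so lowest
    degrees add; [rcomm_high] uses the same for highest degrees. *)
Lemma rcomm_low A n : bounded_operator A -> rcomm A ->
  (forall j, low_degree n (A (ket (vac P j)))) ->
  forall m x, low_degree m x -> low_degree (m + n) (A x).
Proof.
move=> bA rA An m x xm s smn; have [M _ AM] := bounded_pos bA.
apply: (@coord0_of_ket R B B A M (fun t => m <= deg t)%N x s bA.1 AM) => t; last first.
  by rewrite -ltnNge; exact: xm.
move=> mt; rewrite rcomm_ket// rcreateE.
case E : (rptr _ _ _ s) => [u|//]; move/rptrP: E => [sE _ _ _].
by rewrite An ?cmulr0//; rewrite sE in smn; lia.
Qed.

Lemma rcomm_high A n : bounded_operator A -> rcomm A ->
  (forall j, high_degree n (A (ket (vac P j)))) ->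
  forall m x, high_degree m x -> high_degree (m + n) (A x).
Proof.
move=> bA rA An m x xm s smn; have [M _ AM] := bounded_pos bA.
apply: (@coord0_of_ket R B B A M (fun t => deg t <= m)%N x s bA.1 AM) => t; last first.
  by rewrite -ltnNge; exact: xm.
move=> mt; rewrite rcomm_ket// rcreateE.
case E : (rptr _ _ _ s) => [u|//]; move/rptrP: E => [sE _ _ _].
by rewrite An ?cmulr0//; rewrite sE in smn; lia.
Qed.

Lemma is_S_ket n a A t s : is_S P n a A ->
  A (ket t) s = if (deg s == n + deg t)%N && (src s == src t) then
    a (tgt s) (tgt t) * shift_weight n (tgt s) (tgt t) s t else 0.
Proof.
move=> [_ ->]; case: ifP => // /andP[/eqP sd /eqP ss].
rewrite /shift_weight /amp sd ss sqrtrM ?mulr_ge0 ?mpow_ge0//.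
by rewrite sqrtrM ?mpow_ge0// sqrtrV ?mpow_ge0.
Qed.

(** On a ket, one operator acts on the target and the other on the source, and in both orders the
    amplitude of the intermediate vector cancels from the weight. *)
Lemma is_S_rcomm n a A : Arv P n a -> is_S P n a A -> rcomm A.
Proof.
move=> [a0 _] SA l i j; have bA := SA.1; have lA := bA.1.
suff AR : A \o rcreate l i j = rcreate l i j \o A.
  by move=> x; rewrite -[LHS]/((A \o rcreate l i j) x) AR.
have [ij|nij] := boolP (Gr (mpow P l) i j); last first.
  by apply/funext => x /=; rewrite !rcreate_eq0// (lin0 lA).
apply: eq_on_kets; [exact: bounded_comp bA (rcreate_bounded _ _ _)|
  exact: bounded_comp (rcreate_bounded _ _ _) bA|].
move=> t /=; apply: ell2P => s; rewrite rcreateE.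
have [ti|ti] := eqVneq (src t) i; last first.
  rewrite rcreate_ket0// (lin0 lA).
  case E : (rptr l i j s) => [u|//]; move/rptrP: E => [_ _ ui _].
  by rewrite (is_S_ket _ _ SA) ui [i == _]eq_sym (negbTE ti) andbF cmulr0.
have [t' [td tt ts ->]] := rcreate_ket ij ti.
rewrite (linZ lA) ell2ZE !(is_S_ket _ _ SA) td tt ts.
case E : (rptr l i j s) => [u|].
  move/rptrP: E => [sd st us ss]; rewrite (is_S_ket _ _ SA) sd ss us ti !eqxx !andbT.
  rewrite -st addnCA eqn_add2l; case: ifP => _; last by rewrite !cmulr0.
  rewrite mulrCA [RHS]mulrCA; congr (_ * _).
  rewrite /shift_weight -!rmorphM; congr (rc _).
  have := amp_neq0 u; have := amp_neq0 t'; have := amp_neq0 s => ? ? ?.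
  by field; do ?[apply/andP; split].
case: ifP => [/andP[/eqP sd /eqP ss]|_]; last exact: cmulr0.
(* Here the right shift reads no index at [s], so the other side must vanish too. If the matrix
   entry were supported by an edge of P^n, the missing intermediate index would exist. *)
rewrite a0 ?cmul0r ?cmulr0//; apply/negP => G1.
have G2 := Gr_mpow_mul stoP G1 (Gr_idx t).
have [u [ud ut us]] := mkidx_Gr G2.
have : rptr l i j s = Some u by apply/rptrP; rewrite ud ut us sd; split=> //; lia.
by rewrite E.
Qed.

Lemma rcomm_lin c A A' : rcomm A -> rcomm A' -> rcomm (c *: A + A').
Proof.
move=> rA rA' l i j x; rewrite !opE rA rA'.
by rewrite (rcreate_bounded l i j).1.
Qed.

Lemma rcomm_comp A A' : rcomm A -> rcomm A' -> rcomm (A \o A').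
Proof. by move=> rA rA' l i j x; rewrite /= rA' rA. Qed.

Definition polynomial_op : set (ell2 R B -> ell2 R B) :=
  [set A | [/\ bounded_operator A, rcomm A &
    exists N, forall j, high_degree N (A (ket (vac P j)))]].

Lemma polynomial_closure_algebra :
  closed_operator_algebra (norm_closure polynomial_op).
Proof.
apply: norm_closure_algebra.
- by move=> A [].
- move=> c A A' [bA rA [N AN]] [bA' rA' [N' AN']]; split.
  + exact: bounded_lin.
  + exact: rcomm_lin.
  + exists (maxn N N') => j s sN; rewrite opE ell2DE ell2ZE.
    rewrite (AN j s) ?(AN' j s) ?cmulr0 ?caddr0//.
      exact: leq_ltn_trans (leq_maxr _ _) sN.
    exact: leq_ltn_trans (leq_maxl _ _) sN.
- move=> A A' [bA rA [N AN]] [bA' rA' [N' AN']]; split.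
  + exact: bounded_comp.
  + exact: rcomm_comp.
  + by exists (N' + N)%N => j /=; apply: (rcomm_high bA rA).
Qed.

Lemma is_S_polynomial n a A : Arv P n a -> is_S P n a A -> polynomial_op A.
Proof.
move=> aA SA; split; [exact: SA.1|exact: is_S_rcomm SA|].
exists n => j s ns; rewrite (is_S_ket _ _ SA) deg_vac addn0.
by rewrite (gtn_eqF ns).
Qed.

(** By minimality of the tensor algebra. Boundedness, commutation with right shifts and
    approximation by bounded degree are all drawn from this inclusion. *)
Lemma tensor_algebra_sub : tensor_algebra P `<=` norm_closure polynomial_op.
Proof.
move=> A /(_ (norm_closure polynomial_op)); apply; split.
  exact: polynomial_closure_algebra.
move=> A' [n [a [aA SA]]]; split; first exact: SA.1.
move=> e e0; exists A'; first exact: is_S_polynomial SA.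
rewrite subrr (le_lt_trans _ e0)//; apply: opnorm_bound => // x.
by rewrite mul0r l2norm0.
Qed.

Lemma tensor_algebra_bounded A : tensor_algebra P A -> bounded_operator A.
Proof. by case/tensor_algebra_sub. Qed.

Lemma tensor_algebra_closed : closed_operator_algebra (tensor_algebra P).
Proof.
split.
- exact: tensor_algebra_bounded.
- move=> c A A' XA XA' X [cX gX]; case: (cX) => _ + _ _; apply.
    exact: XA (conj cX gX).
  exact: XA' (conj cX gX).
- move=> A A' XA XA' X [cX gX]; case: (cX) => _ _ + _; apply.
    exact: XA (conj cX gX).
  exact: XA' (conj cX gX).
- move=> A bA XA X [cX gX]; case: (cX) => _ _ _; apply => // e e0.
  have [A' XA' AA'] := XA e e0; exists A' => //.
  exact: XA' (conj cX gX).
Qed.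

Lemma tensor_algebra_gen n a A : Arv P n a -> is_S P n a A -> tensor_algebra P A.
Proof. by move=> aA SA X [_]; apply; exists n, a. Qed.

Lemma norm_closure_rcomm A : norm_closure polynomial_op A -> rcomm A.
Proof.
move=> [bA XA] l i j x; apply: ell2P => s; apply/eqP; rewrite -subr_eq0; apply/eqP.
apply: eq0_normc; apply/eqP; rewrite eq_le normc_ge0 andbT.
apply/ler_addgt0Pr => e e0; rewrite add0r.
(* The commutator of [A] with the right shift equals that of [A - A'], whose two terms are each at
   most [opnorm (A - A') * l2norm x]; hence the 2. *)
have x1 : 0 < 2 * (l2norm x + 1) by rewrite mulr_gt0// ltr_wpDl ?l2norm_ge0.
have [A' [bA' rA' _] AA'] := XA _ (divr_gt0 e0 x1).
have bAA := bounded_sub bA bA'; have bR := rcreate_bounded l i j.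
have -> : A (rcreate l i j x) s - rcreate l i j (A x) s =
    (A - A') (rcreate l i j x) s - rcreate l i j ((A - A') x) s.
  rewrite !opBE !ell2BE rA' (linB bR.1) ell2BE.
  by rewrite opprB addrA subrK.
rewrite (le_trans (normcD _ _))// normc_opp.
have Rx : normc ((A - A') (rcreate l i j x) s) <= opnorm (A - A') * l2norm x.
  rewrite (le_trans (coord_le _ _))// (le_trans (opnorm_le _ bAA))//.
  by rewrite ler_wpM2l ?opnorm_ge0// rcreate_norm.
have xR : normc (rcreate l i j ((A - A') x) s) <= opnorm (A - A') * l2norm x.
  by rewrite (le_trans (coord_le _ _))// (le_trans (rcreate_norm _ _ _ _))// opnorm_le.
have := l2norm_ge0 x; have := opnorm_ge0 bAA.
by move: AA' Rx xR; rewrite ltr_pdivlMr//; nra.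
Qed.

Lemma tensor_algebra_rcomm A : tensor_algebra P A -> rcomm A.
Proof. by move=> /tensor_algebra_sub; exact: norm_closure_rcomm. Qed.

Lemma lcreate_is_S n i j : Gr (mpow P n) i j ->
  let a i' j' := ((i' == i) && (j' == j))%:R in Arv P n a /\ is_S P n a (lcreate n i j).
Proof.
move=> ij a; split; last first.
  split=> [|t s]; first exact: lcreate_bounded.
  rewrite (wshift_ketE (lcreate_contractive _ _ _)) lptrE /a.
  case: eqP => //= sd; case: (eqVneq (src s) (src t)) => [ss|_]; last by rewrite !andbF.
  rewrite andbT; case: (eqVneq (tgt s) i) => //= [si|_]; last by rewrite mul0r.
  case: (eqVneq (tgt t) j) => //= [tj|_]; last by rewrite mul0r.
  rewrite mul1r /shift_weight /amp sd ss sqrtrM ?mulr_ge0 ?mpow_ge0//.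
  by rewrite sqrtrM ?mpow_ge0// sqrtrV ?mpow_ge0// si tj.
split.
  move=> i' j' nij; rewrite /a; case: eqP => [ii|//]; case: eqP => [jj|//].
  by move: nij; rewrite ii jj ij.
apply: (@le_lt_trans _ _ 1%:E); last exact: ltry.
apply: ge_ereal_sup => _ [j' _ <-]; apply: esum_le_fin => [i'|F uF].
  exact: sqr_ge0.
apply: (@le_trans _ _ (\sum_(i' <- F) (i' == i)%:R)).
  apply: ler_sum => i' _; rewrite /a; case: (i' == i) => /=; last first.
    by rewrite normc0 expr0n.
  by case: (j' == j); rewrite ?normc1 ?normc0 ?expr1n ?expr0n// ler01.
have [iF|iF] := boolP (i \in F).
  rewrite (bigD1_seq i)//= eqxx big1 ?addr0// => k /negbTE ->//.
rewrite big_seq big1 ?ler01// => k kF; case: eqP => // ki.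
by rewrite -ki kF in iF.
Qed.

(** The closure conditions alone are met by the empty set, so 0 is obtained from a generator, for
    which [i] provides a state. *)
Lemma tensor_algebra0 (i : T) : tensor_algebra P 0.
Proof.
have [a0 S0] := lcreate_is_S (Gr_mpow0 P i).
have A0 := tensor_algebra_gen a0 S0.
have [_ lin _ _] := tensor_algebra_closed.
by have := lin (-1) _ _ A0 A0; rewrite scaleN1r addNr.
Qed.

Lemma lcreate_tensor n i j : tensor_algebra P (lcreate n i j).
Proof.
have [ij|nij] := boolP (Gr (mpow P n) i j); last first.
  have -> : lcreate n i j = 0 by apply/funext => x; rewrite lcreate_eq0.
  exact: tensor_algebra0 i.
by have [aA SA] := lcreate_is_S ij; exact: tensor_algebra_gen SA.
Qed.

Lemma lcreate_comp n m i j k : Gr (mpow P n) i j -> Gr (mpow P m) j k ->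
  lcreate n i j \o lcreate m j k =
  rc (Num.sqrt (mpow P n i j) * Num.sqrt (mpow P m j k)
      / Num.sqrt (mpow P (n + m) i k)) *: lcreate (n + m) i k.
Proof.
move=> ij jk; have ik := Gr_mpow_mul stoP ij jk.
have [_ lin comp _] := tensor_algebra_closed.
have tA : tensor_algebra P (lcreate n i j \o lcreate m j k).
  by apply: comp; exact: lcreate_tensor.
have tA' c : tensor_algebra P (c *: lcreate (n + m) i k).
  by rewrite -[_ *: _]addr0; apply: lin; [exact: lcreate_tensor|exact: tensor_algebra0 i].
apply: rcomm_eq; [exact: tensor_algebra_bounded|exact: tensor_algebra_rcomm|
  exact: tensor_algebra_bounded|exact: tensor_algebra_rcomm|] => j'.
rewrite /= opZE; have [->|kj'] := eqVneq j' k; last first.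
  by rewrite !lcreate_ket0 ?tgt_vac// scaler0 (lin0 (lcreate_bounded _ _ _).1).
have [s [sd st ss ->]] := lcreate_vac jk.
have [u [ud ut us ->]] := lcreate_vac ik.
have [v [vd vt vs ->]] := lcreate_ket ij st.
have -> : v = u by apply: idxP; rewrite ?vd ?vt ?vs ?sd ?ss.
by rewrite /shift_weight /amp ud ut us sd st ss.
Qed.

End LeftRightShifts.

Arguments lcreate {R T} P n i j.
(** * Contractive idempotents *)

Section Projections.
Local Open Scope classical_set_scope.
Local Open Scope ring_scope.
Context {R : realType} {T : countType}.
Variable P : T -> T -> R.
Hypothesis stoP : stochastic P.
Local Notation B := (basis_index P).
Local Notation rc := (real_complex R).
Local Notation kvac j := (ket (vac P j) : ell2 R B).
Implicit Types (s t u : B) (x y : ell2 R B) (A E : ell2 R B -> ell2 R B).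

(** The vacuum at [j] is fixed by the right projection [rcreate 0 j j], which commutes with [A] and
    only keeps source [j]. *)
Lemma vac_source A j s : rcomm A -> src s != j -> A (kvac j) s = 0.
Proof.
move=> rA sj; have := rcreate_vac stoP (vac P j); rewrite deg_vac tgt_vac src_vac => <-.
rewrite rA rcreateE//; case E : (rptr _ _ _ s) => [u|//].
by move/rptrP: E => [_ _ _ sE]; rewrite sE eqxx in sj.
Qed.

Lemma low_degree_comm A m x : bounded_operator A -> rcomm A ->
  low_degree m x -> low_degree m (A x).
Proof. by move=> bA rA xm; rewrite -[m]addn0; apply: (rcomm_low stoP bA rA). Qed.

Lemma vac_decomp A j : rcomm A ->
  low_degree 1 (A (kvac j) - A (kvac j) (vac P j) *: kvac j).
Proof.
move=> rA s; rewrite ltnS leqn0 ell2BE ell2ZE ketE => /eqP /deg0_vac s0.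
have [sj|sj] := eqVneq (src s) j; first by rewrite s0 sj eqxx cmulr1 subrr.
rewrite vac_source//; case: eqP => [sv|_]; last by rewrite cmulr0 subrr.
by rewrite sv src_vac eqxx in sj.
Qed.

(** The degree-zero coefficient at [j] is a character: [A'] maps the vacuum to a multiple of itself
    plus terms of positive degree, and [A] cannot lower degrees. *)
Lemma vac_coef_comp A A' j : bounded_operator A -> rcomm A -> rcomm A' ->
  (A \o A') (kvac j) (vac P j) = A (kvac j) (vac P j) * A' (kvac j) (vac P j).
Proof.
move=> bA rA rA'; have := low_degree_comm bA rA (vac_decomp j rA').
move=> /(_ (vac P j)); rewrite deg_vac => /(_ isT).
rewrite (linB bA.1) (linZ bA.1) ell2BE ell2ZE => /eqP; rewrite subr_eq0 => /eqP ->.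
by rewrite mulrC.
Qed.

Definition contractive_idempotent E :=
  [/\ tensor_algebra P E, E \o E = E & opnorm E <= 1].

Lemma contraction_le A x : bounded_operator A -> opnorm A <= 1 ->
  l2norm (A x) <= l2norm x.
Proof.
move=> bA A1; rewrite (le_trans (opnorm_le _ bA))// -[leRHS]mul1r.
by rewrite ler_wpM2r ?l2norm_ge0.
Qed.

Lemma unit_coord (x : ell2 R B) t : l2norm x <= 1 -> 1 <= normc (x t) ->
  forall s, s != t -> x s = 0.
Proof.
move=> x1 xt s st; have := @sum_le_l2 _ _ x [:: s; t].
rewrite /= inE st => /(_ isT); rewrite !big_cons big_nil addr0 => xx.
have X1 : l2norm x ^+ 2 <= 1 by rewrite expr_le1 ?l2norm_ge0.
have T1 : 1 <= normc (x t) ^+ 2 by rewrite expr_ge1 ?normc_ge0.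
apply: eq0_normc; apply/eqP; rewrite -sqrf_eq0; apply/eqP.
by apply/eqP; rewrite eq_le sqr_ge0 andbT; move: xx X1 T1; lra.
Qed.

(* If the degree-zero coefficient vanishes, the range vector [w] of the vacuum
   is fixed and [(1 + t) w] is the image of [vac + t w], whose norm squared is
   at most [1 + t^2 |w|^2]; let [t] grow. *)
Lemma idempotent_vac E j : contractive_idempotent E ->
  E (kvac j) = kvac j \/ E (kvac j) = 0.
Proof.
move=> [TE EE E1]; have bE := tensor_algebra_bounded stoP TE.
have rE := tensor_algebra_rcomm stoP TE; set v := kvac j.
have Ev1 : l2norm (E v) <= 1 by rewrite (le_trans (contraction_le _ bE E1))// l2norm_ket.
have := vac_coef_comp j bE rE rE; rewrite EE -/v; set c := E v (vac P j) => cc.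
have [c0|c0] := eqVneq c 0; [right|left].
  set w := E v; have wv : w (vac P j) = 0 by [].
  have Ew : E w = w by rewrite -[LHS]/((E \o E) v) EE.
  apply: l2norm_eq0; rewrite leNgt; apply/negP => w0.
  have w20 : 0 < l2norm w ^+ 2 by rewrite exprn_gt0.
  (* This value is already large enough: as [t * l2norm w ^+ 2] is 1, the two bounds combine to
     [l2norm w ^+ 2 + 2 + t <= 1 + t]. *)
  pose t := (l2norm w ^+ 2)^-1.
  have t0 : 0 < t by rewrite invr_gt0.
  have Evt : E (v + rc t *: w) = rc (1 + t) *: w.
    by rewrite (linD bE.1) (linZ bE.1) Ew rmorphD rmorph1 scalerDl scale1r.
  have : l2norm (rc (1 + t) *: w) ^+ 2 <= 1 + t ^+ 2 * l2norm w ^+ 2.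
    apply: le_trans (l2norm_ketD t wv); rewrite -Evt.
    by rewrite ler_pXn2r ?nnegrE ?l2norm_ge0// contraction_le.
  have -> : l2norm (rc (1 + t) *: w) = (1 + t) * l2norm w.
    apply/eqP; rewrite eq_le; apply/andP; split.
      by rewrite (le_trans (l2normZ_le _ _))// normc_real ger0_norm// addr_ge0// ltW.
    have t1 : 0 < 1 + t by rewrite addr_gt0.
    rewrite -ler_pdivlMl//; apply: (@le_trans _ _ (l2norm (rc (1 + t)^-1 *: (rc (1 + t) *: w)))).
      by rewrite scalerA -rmorphM mulVf ?gt_eqF// rmorph1 scale1r.
    by rewrite (le_trans (l2normZ_le _ _))// normc_real gtr0_norm ?invr_gt0.
  rewrite exprMn.
  have tw : t * l2norm w ^+ 2 = 1 by rewrite mulVf// gt_eqF.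
  have -> : (1 + t) ^+ 2 * l2norm w ^+ 2 =
    l2norm w ^+ 2 + 2 * (t * l2norm w ^+ 2) + t * (t * l2norm w ^+ 2) by ring.
  have -> : t ^+ 2 * l2norm w ^+ 2 = t * (t * l2norm w ^+ 2) by ring.
  by rewrite tw; lra.
have c1 : c = 1.
  by apply: (mulfI c0); rewrite -cc cmulr1.
apply: ell2P => s; have [->|sv] := eqVneq s (vac P j).
  by rewrite ketE eqxx -/v -/c c1.
rewrite ketE (negbTE sv); apply: (unit_coord Ev1 _ sv).
by rewrite -/c c1 normc1.
Qed.

Definition vproj i := lcreate P 0 i i.

Lemma vproj_ket i t : vproj i (ket t) = if tgt t == i then ket t else 0.
Proof.
rewrite /vproj; case: eqP => [ti|/eqP ti]; last exact: lcreate_ket0.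
have [s [sd st ss ->]] := lcreate_ket stoP (Gr_mpow0 P i) ti.
have -> : s = t by apply: idxP; rewrite ?sd ?st ?ss ?ti.
by rewrite /shift_weight /= eqxx sqrtr1 mul1r divff ?amp_neq0// rmorph1 scale1r.
Qed.

Lemma vproj_vac i j : vproj i (kvac j) = if j == i then kvac j else 0.
Proof. by rewrite vproj_ket tgt_vac. Qed.

Lemma vproj_tensor i : tensor_algebra P (vproj i).
Proof. exact: lcreate_tensor. Qed.

Lemma vproj_bounded i : bounded_operator (vproj i).
Proof. exact: lcreate_bounded. Qed.

Lemma lcreate_opnorm n i j : opnorm (lcreate P n i j) <= 1.
Proof. by apply: opnorm_bound => // x; rewrite mul1r lcreate_norm. Qed.

Lemma ket_neq0 t : (ket t : ell2 R B) != 0.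
Proof.
apply/eqP => /(congr1 (fun x : ell2 R B => x t)); rewrite ketE eqxx ell20E.
by move/eqP; rewrite oner_eq0.
Qed.

Lemma tensor_eq A A' : tensor_algebra P A -> tensor_algebra P A' ->
  (forall j, A (kvac j) = A' (kvac j)) -> A = A'.
Proof.
move=> TA TA'; apply: (rcomm_eq stoP).
- exact: tensor_algebra_bounded.
- exact: tensor_algebra_rcomm.
- exact: tensor_algebra_bounded.
- exact: tensor_algebra_rcomm.
Qed.

Lemma vproj_idem i : contractive_idempotent (vproj i).
Proof.
split; [exact: vproj_tensor| |exact: lcreate_opnorm].
have [_ _ comp _] := tensor_algebra_closed stoP.
apply: tensor_eq; [apply: comp; exact: vproj_tensor|exact: vproj_tensor|] => j /=.
by rewrite vproj_vac; case: ifP => [ji|_]; rewrite ?vproj_vac ?ji// (lin0 (vproj_bounded _).1).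
Qed.

Lemma vproj_inj i j : vproj i = vproj j -> i = j.
Proof.
move=> /(congr1 (fun A => A (kvac i))); rewrite !vproj_vac eqxx.
by case: eqP => // _ /eqP; rewrite (negbTE (ket_neq0 _)).
Qed.

Lemma vproj_neq0 i : vproj i <> 0.
Proof.
move=> /(congr1 (fun A => A (kvac i))); rewrite vproj_vac eqxx => /eqP.
by rewrite (negbTE (ket_neq0 _)).
Qed.

Lemma idempotent_vproj E : contractive_idempotent E -> E <> 0 ->
  exists i, E \o vproj i = vproj i.
Proof.
move=> cE E0; have [TE _ _] := cE; have bE := tensor_algebra_bounded stoP TE.
have [i Ei] : exists i, E (kvac i) <> 0.
  apply: contrapT => nE; apply: E0.
  apply: (rcomm_eq stoP bE (tensor_algebra_rcomm stoP TE) bounded0).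
    by move=> l i j x; rewrite (lin0 (rcreate_bounded stoP l i j).1).
  by move=> j; apply: contrapT => Ej; apply: nE; exists j.
exists i; have [_ _ comp _] := tensor_algebra_closed stoP.
apply: tensor_eq; [by apply: comp => //; exact: vproj_tensor|exact: vproj_tensor|] => j /=.
rewrite vproj_vac; case: eqP => [->|_]; last by rewrite (lin0 bE.1).
by have [->//|/Ei] := idempotent_vac i cE.
Qed.

(** [E] fixes or kills each vacuum vector, and a fixed one other than the vacuum at [i] would be
    killed by [vproj i]. *)
Lemma idempotent_minimal E i : contractive_idempotent E -> E <> 0 ->
  vproj i \o E = E -> E = vproj i.
Proof.
move=> cE E0 iE; have [j Ej] := idempotent_vproj cE E0; have [TE _ _] := cE.
have Evj : E (kvac j) = kvac j.
  have := congr1 (fun A => A (kvac j)) Ej; rewrite /= vproj_vac eqxx; exact.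
have := congr1 (fun A => A (kvac j)) iE; rewrite /= Evj vproj_vac.
case: eqP => [ji _|_ /esym/eqP]; last by rewrite (negbTE (ket_neq0 _)).
apply: tensor_eq => //; first exact: vproj_tensor.
move=> k; rewrite vproj_vac; case: eqP => [->|ki]; first by rewrite -ji.
have [Ek|//] := idempotent_vac k cE; exfalso.
have := congr1 (fun A => A (kvac k)) iE; rewrite /= Ek vproj_vac.
by case: eqP ki => // _ _ /esym/eqP; rewrite (negbTE (ket_neq0 _)).
Qed.

End Projections.

Arguments vproj {R T} P i.

(** * Isometric isomorphisms and vertex projections *)

Section Isomorphisms.
Local Open Scope classical_set_scope.
Local Open Scope ring_scope.
Context {R : realType}.

(** The one-sided part of an isomorphism, which [phi] and its inverse share, so that each later
    lemma can be applied in both directions. *)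
Definition isometric_hom {I J : choiceType}
    (X : set (ell2 R I -> ell2 R I)) (Y : set (ell2 R J -> ell2 R J))
    (phi : (ell2 R I -> ell2 R I) -> (ell2 R J -> ell2 R J)) : Prop :=
  [/\ (forall A, X A -> Y (phi A)),
      (forall (c : R[i]) A B, X A -> X B -> phi (c *: A + B) = c *: phi A + phi B),
      (forall A B, X A -> X B -> phi (A \o B) = phi A \o phi B) &
      (forall A, X A -> opnorm (phi A) = opnorm A)].

Lemma isometric_isomorphism_hom (I J : choiceType)
    (X : set (ell2 R I -> ell2 R I)) (Y : set (ell2 R J -> ell2 R J)) phi :
  isometric_isomorphism X Y phi -> isometric_hom X Y phi.
Proof. by case=> -[XY _ _] lin mul iso; split. Qed.

Lemma isometric_isomorphism_inverse (I J : choiceType)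
    (X : set (ell2 R I -> ell2 R I)) (Y : set (ell2 R J -> ell2 R J)) phi :
  closed_operator_algebra X -> closed_operator_algebra Y ->
  isometric_isomorphism X Y phi ->
  exists psi, [/\ isometric_hom Y X psi, (forall A, X A -> psi (phi A) = A) &
    (forall A, Y A -> phi (psi A) = A)].
Proof.
move=> [_ Xl Xm _] [_ Yl Ym _] [[XY inj surj] lin mul iso].
have ex A' : exists A, Y A' -> X A /\ phi A = A'.
  (* The zero operator is a default value outside [Y], where nothing is claimed about [psi]. *)
  have [YA|nYA] := pselect (Y A'); last by exists (fun=> 0).
  by have [A XA AA'] := surj _ YA; exists A.
have /choice[psi psiP] := ex.
have phiX A : X A -> Y (phi A) by exact: XY.
have psiX A : Y A -> X (psi A) by move=> /psiP[].
have phiK A : Y A -> phi (psi A) = A by move=> /psiP[].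
have psiK A : X A -> psi (phi A) = A.
  move=> XA; apply: inj; rewrite ?inE//; first exact/psiX/phiX.
  exact/phiK/phiX.
exists psi; split => //; split => //.
- move=> c A A' YA YA'; rewrite -{1}(phiK A)// -{1}(phiK A')// -lin ?psiK//.
  + by apply: Xl; exact: psiX.
  + exact: psiX.
  + exact: psiX.
- move=> A A' YA YA'; rewrite -{1}(phiK A)// -{1}(phiK A')// -mul ?psiK//.
  + by apply: Xm; exact: psiX.
  + exact: psiX.
  + exact: psiX.
- by move=> A YA; rewrite -[in RHS](phiK A)// iso//; exact: psiX.
Qed.

Lemma hom_lin0 (I J : choiceType)
    (X : set (ell2 R I -> ell2 R I)) (Y : set (ell2 R J -> ell2 R J)) phi A0 :
  isometric_hom X Y phi -> X A0 -> phi 0 = 0.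
Proof.
move=> [_ lin _ _] X0; have := lin (-1) _ _ X0 X0.
by rewrite !scaleN1r !addNr.
Qed.

Context {T U : countType}.
Variables (P : T -> T -> R) (Q : U -> U -> R).
Hypotheses (stoP : stochastic P) (stoQ : stochastic Q).

(** The image of [vproj P i] dominates some [vproj Q j]. Pulled back by [psi], the latter is a
    nonzero contractive idempotent below [vproj P i], hence equal to it by minimality. *)
Lemma hom_vproj phi psi (i : T) :
  isometric_hom (tensor_algebra P) (tensor_algebra Q) phi ->
  isometric_hom (tensor_algebra Q) (tensor_algebra P) psi ->
  (forall A, tensor_algebra P A -> psi (phi A) = A) ->
  (forall A, tensor_algebra Q A -> phi (psi A) = A) ->
  exists j, phi (vproj P i) = vproj Q j.
Proof.
move=> hphi hpsi phiK psiK.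
have [phiX plin pmul piso] := hphi; have [psiX slin smul siso] := hpsi.
have TPi := vproj_tensor stoP i.
have cphi : contractive_idempotent (phi (vproj P i)).
  have [_ EE E1] := vproj_idem stoP i; split; first exact: phiX.
    by rewrite -pmul// EE.
  by rewrite piso.
have phi0 : phi (vproj P i) <> 0.
  move=> phi0; apply: (@vproj_neq0 _ _ _ stoP i).
  by rewrite -(phiK _ TPi) phi0 (hom_lin0 hpsi (phiX _ TPi)).
have [j Ej] := idempotent_vproj stoQ cphi phi0.
have TQj := vproj_tensor stoQ j.
exists j; rewrite -(psiK _ TQj); congr phi; apply/esym.
apply: (idempotent_minimal stoP).
- have [_ EE E1] := vproj_idem stoQ j; split; first exact: psiX.
    by rewrite -smul// EE.
  by rewrite siso.
- move=> psi0; apply: (@vproj_neq0 _ _ _ stoQ j).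
  by rewrite -(psiK _ TQj) psi0 (hom_lin0 hphi TPi).
- by rewrite -[in LHS](phiK _ TPi) -smul ?Ej//; exact: phiX.
Qed.

End Isomorphisms.
(** The new term stands first to match the shape [c *: A + B] in which linearity is stated. *)
Lemma sum_ord_recr (V : nmodType) N (F : nat -> V) :
  (\sum_(m < N.+1) F m = F N + \sum_(m < N) F m)%R.
Proof. by rewrite big_ord_recr; exact: addrC. Qed.

(** * Isomorphisms are graded *)

Section Corners.
Local Open Scope classical_set_scope.
Local Open Scope ring_scope.
Context {R : realType} {T : countType}.
Variable P : T -> T -> R.
Hypothesis stoP : stochastic P.
Local Notation B := (basis_index P).
Local Notation rc := (real_complex R).
Local Notation kvac j := (ket (vac P j) : ell2 R B).
Implicit Types (s t u : B) (x y : ell2 R B) (A E : ell2 R B -> ell2 R B).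

(** The Fourier coefficient of [A] along [lcreate P n i j], read off a vacuum vector; it defaults to
    0 off the graph of P^n. *)
Definition opcoef A n i j : R[i] :=
  if mkidx P n i j is Some s then A (kvac j) s else 0.

Lemma opcoef_idx A s : A (kvac (src s)) s = opcoef A (deg s) (tgt s) (src s).
Proof. by rewrite /opcoef mkidx_def. Qed.

Lemma opcoef_lin c A A' n i j :
  opcoef (c *: A + A') n i j = c * opcoef A n i j + opcoef A' n i j.
Proof.
by rewrite /opcoef; case: (mkidx P n i j) => [s|]; rewrite ?cmulr0 ?caddr0// opE.
Qed.

Lemma opcoef0 n i j : opcoef 0 n i j = 0.
Proof. by rewrite /opcoef; case: (mkidx P n i j). Qed.

Lemma opcoefZ c A n i j : opcoef (c *: A) n i j = c * opcoef A n i j.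
Proof. by rewrite -[c *: A]addr0 opcoef_lin opcoef0 caddr0. Qed.

Lemma opcoefB A A' n i j : opcoef (A - A') n i j = opcoef A n i j - opcoef A' n i j.
Proof. by rewrite subE opcoef_lin mulN1r addrC. Qed.

Lemma opcoef_sum N (F : nat -> ell2 R B -> ell2 R B) n i j :
  opcoef (\sum_(m < N) F m) n i j = \sum_(m < N) opcoef (F m) n i j.
Proof.
elim: N => [|N IH]; first by rewrite !big_ord0 opcoef0.
rewrite (sum_ord_recr N F) (sum_ord_recr N (fun m => opcoef (F m) n i j)) -IH.
by rewrite -{1}(scale1r (F N)) opcoef_lin cmul1r.
Qed.

Lemma opcoef_le A n i j : bounded_operator A -> normc (opcoef A n i j) <= opnorm A.
Proof.
move=> bA; rewrite /opcoef; case: (mkidx P n i j) => [s|]; first exact: coord_opnorm.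
by rewrite normc0 opnorm_ge0.
Qed.

Lemma opcoef_lcreate n m i j : Gr (mpow P n) i j ->
  opcoef (lcreate P n i j) m i j = (m == n)%:R.
Proof.
move=> ij; have [s [sd st ss sE]] := lcreate_vac stoP ij.
rewrite /opcoef sE; case E : (mkidx P m i j) => [u|].
  move/mkidxP: E => [ud ut us]; rewrite ketE; congr (nat_of_bool _)%:R.
  apply/eqP/eqP => [us'|mn]; first by rewrite -ud us' sd.
  by apply: idxP; rewrite ?ud ?ut ?us ?sd ?st ?ss.
case: eqP => // mn; have : mkidx P m i j = Some s by apply/mkidxP; rewrite mn.
by rewrite E.
Qed.

Lemma lcreate_nGr n i j : ~~ Gr (mpow P n) i j -> lcreate P n i j = 0.
Proof. by move=> nij; apply/funext => x; rewrite lcreate_eq0. Qed.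

Definition corner A i j := vproj P i \o A \o vproj P j.

Lemma corner_tensor A i j : tensor_algebra P A -> tensor_algebra P (corner A i j).
Proof.
have [_ _ comp _] := tensor_algebra_closed stoP => TA.
exact: comp _ _ (comp _ _ (vproj_tensor stoP i) TA) (vproj_tensor stoP j).
Qed.

Lemma vprojE i x s : vproj P i x s = if tgt s == i then x s else 0.
Proof.
rewrite /vproj lcreateE//; case E : (lptr _ _ _ s) => [t|].
  move/lptrP: E => [sd st tt ss]; rewrite st eqxx.
  have -> : s = t by apply: idxP; rewrite ?sd ?st ?tt ?ss.
  by rewrite /shift_weight /= eqxx sqrtr1 mul1r divff ?amp_neq0// rmorph1 cmul1r.
case: eqP => // si; suff : lptr 0 i i s = Some s by rewrite E.
by apply/lptrP; rewrite add0n.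
Qed.

Lemma corner_vac A i j k s : bounded_operator A -> rcomm A -> corner A i j = A ->
  A (kvac k) s = if [&& k == j, src s == j & tgt s == i] then A (kvac k) s else 0.
Proof.
move=> bA rA cA; have [->|kj] := eqVneq k j; last first.
  rewrite -[in LHS]cA /corner /= vproj_vac// (negbTE kj) (lin0 bA.1).
  by rewrite (lin0 (vproj_bounded stoP _).1).
have [sj|sj] := eqVneq (src s) j; last by rewrite (vac_source stoP).
have [si|si] := eqVneq (tgt s) i => //=.
by rewrite -[in LHS]cA /corner /= vprojE (negbTE si).
Qed.

Lemma corner_lcreate n i j : corner (lcreate P n i j) i j = lcreate P n i j.
Proof.
have TL := lcreate_tensor stoP n i j.
apply: (tensor_eq stoP); [exact: corner_tensor|exact: TL|] => k.
rewrite /corner /= vproj_vac//; have [->|kj] := eqVneq k j; last first.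
  rewrite (lin0 (lcreate_bounded stoP _ _ _).1) (lin0 (vproj_bounded stoP _).1).
  by rewrite lcreate_ket0.
have [ij|nij] := boolP (Gr (mpow P n) i j); last first.
  by rewrite lcreate_nGr// (lin0 (vproj_bounded stoP _).1).
have [s [sd st ss ->]] := lcreate_vac stoP ij.
by rewrite vproj_ket// st eqxx.
Qed.

Lemma corner_eq A A' i j : bounded_operator A -> rcomm A -> corner A i j = A ->
  bounded_operator A' -> rcomm A' -> corner A' i j = A' ->
  (forall n, opcoef A n i j = opcoef A' n i j) -> A = A'.
Proof.
move=> bA rA cA bA' rA' cA' AA'; apply: (rcomm_eq stoP) => // k; apply: ell2P => s.
rewrite (corner_vac _ _ bA rA cA) (corner_vac _ _ bA' rA' cA').
case: ifP => // /and3P[/eqP -> /eqP sj /eqP si].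
by rewrite -{1 2}sj !opcoef_idx si sj AA'.
Qed.

Lemma sum_lcreate_tensor N (b : nat -> R[i]) i j :
  tensor_algebra P (\sum_(m < N) b m *: lcreate P m i j).
Proof.
have [_ lin _ _] := tensor_algebra_closed stoP.
elim: N => [|N IH]; first by rewrite big_ord0; exact: (tensor_algebra0 stoP i).
by rewrite (sum_ord_recr N (fun m => b m *: lcreate P m i j)); apply: lin => //; exact: lcreate_tensor.
Qed.

Lemma vprojD i x y : vproj P i (x + y) = vproj P i x + vproj P i y.
Proof. by rewrite (linD (vproj_bounded stoP i).1). Qed.

Lemma corner_lin c A A' i j :
  corner (c *: A + A') i j = c *: corner A i j + corner A' i j.
Proof.
apply/funext => x; rewrite /corner opE /= opE vprojD.
by rewrite (linZ (vproj_bounded stoP i).1).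
Qed.

Lemma corner_sub A A' i j : corner (A - A') i j = corner A i j - corner A' i j.
Proof. by rewrite subE corner_lin -subE. Qed.

Lemma corner_sum N (b : nat -> R[i]) i j :
  corner (\sum_(m < N) b m *: lcreate P m i j) i j = \sum_(m < N) b m *: lcreate P m i j.
Proof.
elim: N => [|N IH].
  rewrite big_ord0; apply/funext => x; rewrite /corner /=.
  exact: (lin0 (vproj_bounded stoP i).1).
by rewrite (sum_ord_recr N (fun m => b m *: lcreate P m i j)) corner_lin IH corner_lcreate.
Qed.

Lemma corner_opnorm A i j : bounded_operator A -> opnorm (corner A i j) <= opnorm A.
Proof.
move=> bA; apply: opnorm_bound => [|x]; first exact: opnorm_ge0.
rewrite /corner (le_trans (lcreate_norm stoP _ _ _ _))// (le_trans (opnorm_le _ bA))//.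
by rewrite ler_wpM2l ?opnorm_ge0// (lcreate_norm stoP).
Qed.

(** Compression to the corner is contractive and fixes [A]. Applied to an approximant of bounded
    degree, it leaves at most one coefficient in each degree, hence a finite sum even over
    infinitely many states. *)
Lemma corner_approx A i j (e : R) : tensor_algebra P A -> corner A i j = A -> 0 < e ->
  exists N (b : nat -> R[i]),
    opnorm (A - \sum_(m < N) b m *: lcreate P m i j) < e.
Proof.
move=> TA cA e0; have [bA XA] := tensor_algebra_sub stoP TA.
have [X [bX rX [N XN]] AX] := XA e e0.
pose b m := opcoef (corner X i j) m i j; exists N.+1, b.
have bi := vproj_bounded stoP i; have bj := vproj_bounded stoP j.
have ri := tensor_algebra_rcomm stoP (vproj_tensor stoP i).
have rj := tensor_algebra_rcomm stoP (vproj_tensor stoP j).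
suff <- : corner X i j = \sum_(m < N.+1) b m *: lcreate P m i j.
  by rewrite -cA -corner_sub (le_lt_trans (corner_opnorm _ _ (bounded_sub bA bX))).
have TS := sum_lcreate_tensor N.+1 b i j.
have vK k : vproj P k \o vproj P k = vproj P k by have [] := vproj_idem stoP k.
apply: (@corner_eq _ _ i j).
- exact: bounded_comp (bounded_comp bi bX) bj.
- exact: rcomm_comp (rcomm_comp ri rX) rj.
- rewrite /corner -[in RHS](vK i) -[in RHS](vK j); by [].
- exact: tensor_algebra_bounded TS.
- exact: tensor_algebra_rcomm TS.
- exact: corner_sum.
move=> n; rewrite (opcoef_sum N.+1 (fun m => b m *: lcreate P m i j)) -/(b n).
have [nN|nN] := ltnP n N.+1; last first.
  have -> : b n = 0.
    rewrite /b /opcoef; case E : (mkidx P n i j) => [s|//].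
    move/mkidxP: E => [sd st ss]; rewrite /corner /= vproj_vac// eqxx vprojE st eqxx.
    by apply: XN; rewrite sd.
  rewrite big1// => m _; rewrite opcoefZ.
  have [mG|mG] := boolP (Gr (mpow P m) i j); last by rewrite lcreate_nGr// opcoef0 cmulr0.
  by rewrite opcoef_lcreate// gtn_eqF ?cmulr0// (leq_trans (ltn_ord m)).
have bn m : opcoef (b m *: lcreate P m i j) n i j = if m == n then b n else 0.
  rewrite opcoefZ; have [mG|mG] := boolP (Gr (mpow P m) i j); last first.
    rewrite lcreate_nGr// opcoef0 cmulr0; case: eqP => // mn.
    rewrite /b /opcoef; case E : (mkidx P n i j) => [s|//]; move/mkidxP : E => [sd st ss].
    by move: mG; rewrite mn -sd -st -ss Gr_idx.
  rewrite opcoef_lcreate// eq_sym; case: eqP => [->|_]; last exact: cmulr0.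
  exact: cmulr1.
rewrite (bigD1 (Ordinal nN))//= bn eqxx big1 ?caddr0// => m mn; rewrite bn.
by case: eqP => // mn'; case/eqP: mn; apply: val_inj.
Qed.

End Corners.

Section OrderFiltration.
Local Open Scope classical_set_scope.
Local Open Scope ring_scope.
Context {R : realType} {T : countType}.
Variable P : T -> T -> R.
Hypothesis stoP : stochastic P.
Local Notation B := (basis_index P).

Definition order_ge n (A : ell2 R B -> ell2 R B) :=
  forall j, low_degree n (A (ket (vac P j))).

Lemma order_ge_comp n m A A' : tensor_algebra P A ->
  order_ge n A -> order_ge m A' -> order_ge (m + n) (A \o A').
Proof.
move=> TA An Am j; apply: (rcomm_low stoP _ _ An) => //.
- exact: tensor_algebra_bounded TA.
- exact: tensor_algebra_rcomm TA.
Qed.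

Lemma order_geZ n c A : order_ge n A -> order_ge n (c *: A).
Proof. by move=> An j s sn; rewrite opZE ell2ZE An ?cmulr0. Qed.

Lemma order_ge_coef n A m i j : order_ge n A -> (m < n)%N -> opcoef A m i j = 0.
Proof.
move=> An mn; rewrite /opcoef; case E : (mkidx P m i j) => [s|//].
by move/mkidxP: E => [sd _ _]; rewrite An ?sd.
Qed.

Lemma order_ge0 A : order_ge 0 A.
Proof. by []. Qed.

(** Degree zero consists of the vacuum vectors, and the corner (i, j) meets them only if [i] is [j],
    in one coefficient. *)
Lemma order_ge1_vac A i j : tensor_algebra P A -> corner A i j = A ->
  (i = j -> A (ket (vac P i)) (vac P i) = 0) -> order_ge 1 A.
Proof.
move=> TA cA A0 k s; rewrite ltnS leqn0 => /eqP /deg0_vac sv.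
rewrite (corner_vac stoP _ _ (tensor_algebra_bounded stoP TA)
  (tensor_algebra_rcomm stoP TA) cA).
case: ifP => // /and3P[/eqP -> /eqP sj /eqP si].
have ij : i = j by rewrite -si sv tgt_vac sj.
by rewrite sv sj -ij A0.
Qed.

End OrderFiltration.

(** * Homomorphisms do not lower the order *)

Section GradedHomomorphisms.
Local Open Scope classical_set_scope.
Local Open Scope ring_scope.
Context {R : realType} {T U : countType}.
Variables (P : T -> T -> R) (Q : U -> U -> R).
Hypotheses (stoP : stochastic P) (stoQ : stochastic Q).
Local Notation rc := (real_complex R).
Local Notation TP := (tensor_algebra P).
Local Notation TQ := (tensor_algebra Q).
Local Notation opP := (ell2 R (basis_index P) -> ell2 R (basis_index P)).
Variables (phi : opP -> (ell2 R (basis_index Q) -> ell2 R (basis_index Q))).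
Variable sigma : T -> U.
Hypothesis homphi : isometric_hom TP TQ phi.
Hypothesis phi_vproj : forall i, phi (vproj P i) = vproj Q (sigma i).
Hypothesis sigma_inj : injective sigma.

Let phiX A : TP A -> TQ (phi A). Proof. by have [+ _ _ _] := homphi; apply. Qed.

Let phiM A A' : TP A -> TP A' -> phi (A \o A') = phi A \o phi A'.
Proof. by have [_ _ + _] := homphi; apply. Qed.

Lemma phi0 (i : T) : phi 0 = 0.
Proof. exact: hom_lin0 homphi (tensor_algebra0 stoP i). Qed.

Lemma phiZ (c : R[i]) A (i : T) : TP A -> phi (c *: A) = c *: phi A.
Proof.
move=> TA; have [_ lin _ _] := homphi.
by rewrite -[c *: A]addr0 (lin c _ _ TA (tensor_algebra0 stoP i)) (phi0 i) addr0.
Qed.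

Lemma phi_corner n i j :
  corner (phi (lcreate P n i j)) (sigma i) (sigma j) = phi (lcreate P n i j).
Proof.
have TL := lcreate_tensor stoP n i j.
have Ti := vproj_tensor stoP i; have Tj := vproj_tensor stoP j.
have [_ _ comp _] := tensor_algebra_closed stoP.
rewrite /corner -!phi_vproj -(phiM Ti TL) -(phiM (comp _ _ Ti TL) Tj).
by rewrite -[RHS](congr1 phi (corner_lcreate stoP n i j)).
Qed.

Lemma phi_sum N (b : nat -> R[i]) i j :
  phi (\sum_(m < N) b m *: lcreate P m i j) = \sum_(m < N) b m *: phi (lcreate P m i j).
Proof.
have [_ lin _ _] := homphi.
elim: N => [|N IH]; first by rewrite !big_ord0 (phi0 i).
rewrite (sum_ord_recr N (fun m => b m *: lcreate P m i j)).
rewrite (sum_ord_recr N (fun m => b m *: phi (lcreate P m i j))) -IH.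
by apply: lin; [exact: lcreate_tensor|exact: sum_lcreate_tensor].
Qed.

Lemma comp_weight_neq0 n m i j k : Gr (mpow P n) i j -> Gr (mpow P m) j k ->
  rc (Num.sqrt (mpow P n i j) * Num.sqrt (mpow P m j k)
      / Num.sqrt (mpow P (n + m) i k)) != 0.
Proof.
move=> ij jk; have ik := Gr_mpow_mul stoP ij jk.
rewrite eq_complex /= eqxx andbT !mulf_neq0 ?invr_eq0 ?gt_eqF ?sqrtr_gt0//.
Qed.

Lemma order_phi_neq n i j : i != j -> order_ge 1 (phi (lcreate P n i j)).
Proof.
move=> ij; apply: (order_ge1_vac stoQ (phiX (lcreate_tensor stoP n i j)) (phi_corner n i j)).
by move=> /sigma_inj ij'; rewrite ij' eqxx in ij.
Qed.

Lemma lcreate_pow k n i : Gr (mpow P n) i i ->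
  Gr (mpow P (k * n)) i i /\ exists2 c : R[i], c != 0 &
    iter k (fun A => lcreate P n i i \o A) (vproj P i) = c *: lcreate P (k * n) i i.
Proof.
move=> ii; elim: k => [|k [Gk [c c0 IH]]].
  split; first exact: Gr_mpow0.
  by exists 1; rewrite ?oner_eq0// scale1r.
split; first by rewrite mulSn; exact: Gr_mpow_mul Gk.
rewrite iterS IH.
have -> : lcreate P n i i \o (c *: lcreate P (k * n) i i) =
    c *: (lcreate P n i i \o lcreate P (k * n) i i).
  by apply/funext => x; rewrite /= !opZE (linZ (lcreate_bounded stoP _ _ _).1).
rewrite (lcreate_comp stoP ii Gk) scalerA -mulSn; eexists; last reflexivity.
exact: mulf_neq0 c0 (comp_weight_neq0 ii Gk).
Qed.

Lemma phi_pow k A A0 : TP A -> TP A0 ->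
  TP (iter k (fun B => A \o B) A0) /\
  phi (iter k (fun B => A \o B) A0) = iter k (fun B => phi A \o B) (phi A0).
Proof.
move=> TA TA0; have [_ _ comp _] := tensor_algebra_closed stoP.
elim: k => [//|k [Tk IH]] /=; split; first exact: comp TA Tk.
by rewrite (phiM TA Tk) IH.
Qed.

Lemma vac_coef_pow k A A0 j : TQ A -> TQ A0 ->
  TQ (iter k (fun B => A \o B) A0) /\
  iter k (fun B => A \o B) A0 (ket (vac Q j)) (vac Q j) =
  A (ket (vac Q j)) (vac Q j) ^+ k * A0 (ket (vac Q j)) (vac Q j).
Proof.
move=> TA TA0; have [_ _ comp _] := tensor_algebra_closed stoQ.
elim: k => [|k [Tk IH]]; first by rewrite expr0 cmul1r.
rewrite iterS; split; first exact: comp TA Tk.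
rewrite (vac_coef_comp stoQ j (tensor_algebra_bounded stoQ TA)
  (tensor_algebra_rcomm stoQ TA) (tensor_algebra_rcomm stoQ Tk)).
by rewrite IH exprS mulrA.
Qed.

Local Notation vcoef A j := ((A (ket (vac Q j)) : ell2 R (basis_index Q)) (vac Q j)).

(** The k-th power of a loop is a nonzero multiple of the loop of length [k * n], and the
    degree-zero coefficient is multiplicative. *)
Lemma vcoef_pow_lcreate k n i : Gr (mpow P n) i i -> (0 < k)%N ->
  vcoef (phi (lcreate P n i i)) (sigma i) = 0 <->
  vcoef (phi (lcreate P (k * n) i i)) (sigma i) = 0.
Proof.
move=> ii k0; have [Gk [c c0 pk]] := lcreate_pow k ii.
have TL := lcreate_tensor stoP n i i; have Tv := vproj_tensor stoP i.
have [Tp phip] := phi_pow k TL Tv.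
have [_ vp] := vac_coef_pow k (sigma i) (phiX TL) (phiX Tv).
rewrite -phip pk (phiZ c i (lcreate_tensor stoP _ _ _)) opZE ell2ZE in vp.
have v1 : vcoef (phi (vproj P i)) (sigma i) = 1.
  by rewrite phi_vproj (vproj_vac stoQ) eqxx ketE eqxx.
rewrite v1 cmulr1 {v1} in vp.
split=> v0; move: vp; rewrite v0.
  rewrite expr0n (gtn_eqF k0) => /eqP; rewrite mulf_eq0 (negbTE c0); exact: eqP.
by rewrite cmulr0 => /esym/eqP; rewrite expf_eq0 => /andP[_ /eqP].
Qed.

(* A power of the loop at [i] is proportional to a power of a loop factoring
   through some [j != i], and the latter maps to an operator of positive order. *)
Lemma order_phi_loop n i j : irreducible P -> i != j -> Gr (mpow P n.+1) i i ->
  order_ge 1 (phi (lcreate P n.+1 i i)).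
Proof.
move=> irrP ij ii.
apply: (order_ge1_vac stoQ (phiX (lcreate_tensor stoP _ _ _)) (phi_corner _ _ _)) => _.
have [a Ga] := irr_mpow_pos stoP i j irrP; have [b Gb] := irr_mpow_pos stoP j i irrP.
have [N N0 [GN vN]] : exists2 N, (0 < N)%N & Gr (mpow P N) i i /\
    vcoef (phi (lcreate P N i i)) (sigma i) = 0.
  exists (a.+1 + b.+1)%N => //; split; first exact: (Gr_mpow_mul stoP Ga Gb).
  have T1 := lcreate_tensor stoP a.+1 i j; have T2 := lcreate_tensor stoP b.+1 j i.
  have v0 := @order_phi_neq a.+1 _ _ ij (sigma i) (vac Q (sigma i)) isT.
  have := vac_coef_comp stoQ (sigma i) (tensor_algebra_bounded stoQ (phiX T1))
    (tensor_algebra_rcomm stoQ (phiX T1)) (tensor_algebra_rcomm stoQ (phiX T2)).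
  move=> /(@etrans _ _ _ _)/(_ (etrans (congr1 (fun z => z * _) v0) (cmul0r _))).
  rewrite -(phiM T1 T2) (lcreate_comp stoP Ga Gb) (phiZ _ i (lcreate_tensor stoP _ _ _)).
  rewrite opZE ell2ZE => /eqP.
  by rewrite mulf_eq0 (negbTE (comp_weight_neq0 Ga Gb)) => /eqP.
(* The loops of lengths [N] and [n.+1] meet at length [n.+1 * N]: the vanishing goes up from [N] and
   then down to [n.+1]. *)
have nN := (vcoef_pow_lcreate GN (ltn0Sn n)).1 vN.
by apply: (vcoef_pow_lcreate ii N0).2; rewrite mulnC.
Qed.

(** A path is split off edge by edge: each edge has an image of order at least 1, and orders add.
    When the edge is a loop, one of the two given states differs from its vertex. *)
Lemma order_phi n i j : irreducible P -> (exists k l : T, k != l) ->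
  Gr (mpow P n) i j -> order_ge n (phi (lcreate P n i j)).
Proof.
move=> irrP [k0 [l0 kl]]; elim: n i => [|n IH] i ij; first exact: order_ge0.
have [k [ik kj]] := Gr_mpow_step stoP ij.
have o1 : order_ge 1 (phi (lcreate P 1 i k)).
  have [ikE|ik'] := eqVneq i k; last exact: order_phi_neq.
  rewrite -ikE in ik *; have [ik0|ik0] := eqVneq i k0.
    by apply: (@order_phi_loop 0 i l0 irrP) => //; rewrite ik0.
  exact: (@order_phi_loop 0 i k0 irrP).
have T1 := lcreate_tensor stoP 1 i k; have T2 := lcreate_tensor stoP n k j.
have := congr1 phi (lcreate_comp stoP ik kj); rewrite add1n.
rewrite (phiM T1 T2) (phiZ _ i (lcreate_tensor stoP _ _ _)); set c := rc _ => phiE.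
have c0 : c != 0 by rewrite /c -add1n comp_weight_neq0.
rewrite -[phi _](scalerK c0) -phiE; apply: order_geZ; rewrite -addn1.
exact: (order_ge_comp stoQ (phiX T1) o1 (IH _ kj)).
Qed.

End GradedHomomorphisms.

(** The length [N] of an approximant and the degree [n] are unrelated, so both sums are compared
    over [maxn N n.+1]. *)
Lemma sum_truncate_le (R : realType) (f : nat -> R) N n : (forall m, 0 <= f m)%R ->
  (\sum_(m < N) (m <= n)%N%:R * f m <= \sum_(m < n.+1) f m)%R.
Proof.
move=> f0; have -> : (\sum_(m < n.+1) f m = \sum_(0 <= m < n.+1) f m)%R.
  by rewrite big_mkord.
have -> : (\sum_(m < N) (m <= n)%N%:R * f m =
    \sum_(0 <= m < N) (m <= n)%N%:R * f m)%R by rewrite big_mkord.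
have -> : (\sum_(0 <= m < n.+1) f m =
    \sum_(0 <= m < maxn N n.+1) (m <= n)%N%:R * f m)%R.
  rewrite [RHS](@big_cat_nat _ _ _ n.+1)//= ?leq_maxr//.
  rewrite [X in (_ + X)%R]big_nat_cond [X in (_ + X)%R]big1 ?addr0; last first.
    by move=> m /andP[/andP[nm _] _]; rewrite leqNgt nm mul0r.
  rewrite [LHS]big_nat_cond [RHS]big_nat_cond; apply: eq_bigr => m.
  by move=> /andP[/andP[_ mn] _]; rewrite -ltnS mn mul1r.
rewrite [leRHS](@big_cat_nat _ _ _ N)//= ?leq_maxl//.
by rewrite lerDl sumr_ge0// => m _; rewrite mulr_ge0.
Qed.

(** * Isomorphisms map shifts to unimodular multiples of shifts *)

Section GradedIsomorphisms.
Local Open Scope classical_set_scope.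
Local Open Scope ring_scope.
Context {R : realType} {T U : countType}.
Variables (P : T -> T -> R) (Q : U -> U -> R).
Hypotheses (stoP : stochastic P) (stoQ : stochastic Q).
Hypotheses (irrP : irreducible P) (irrQ : irreducible Q).
Local Notation rc := (real_complex R).
Local Notation TP := (tensor_algebra P).
Local Notation TQ := (tensor_algebra Q).
Local Notation opP := (ell2 R (basis_index P) -> ell2 R (basis_index P)).
Local Notation opQ := (ell2 R (basis_index Q) -> ell2 R (basis_index Q)).
Variables (phi : opP -> opQ) (psi : opQ -> opP) (sigma : T -> U) (tau : U -> T).
Hypotheses (homphi : isometric_hom TP TQ phi) (hompsi : isometric_hom TQ TP psi).
Hypothesis phiK : forall A, TP A -> psi (phi A) = A.
Hypotheses (sigmaK : cancel sigma tau) (tauK : cancel tau sigma).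
Hypothesis phi_vproj : forall i, phi (vproj P i) = vproj Q (sigma i).
Hypothesis two_points : exists k l : T, k != l.

Let psi_vproj j : psi (vproj Q j) = vproj P (tau j).
Proof. by rewrite -{1}(tauK j) -phi_vproj phiK//; exact: vproj_tensor. Qed.

Let two_pointsQ : exists k l : U, k != l.
Proof.
have [k [l kl]] := two_points; exists (sigma k), (sigma l).
by rewrite (inj_eq (can_inj sigmaK)).
Qed.

(** Off the graph the shift itself is zero, below degree [m] the order of its image kills the
    coefficient, and elsewhere contractivity bounds it by 1. *)
Lemma psi_coef_bound n m i j :
  normc (opcoef (psi (lcreate Q m (sigma i) (sigma j))) n i j)
  <= (Gr (mpow Q m) (sigma i) (sigma j) && (m <= n)%N)%:R.
Proof.
have [mG|mG] /= := boolP (Gr (mpow Q m) (sigma i) (sigma j)); last first.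
  by rewrite lcreate_nGr// (phi0 stoQ hompsi (sigma i)) opcoef0 normc0.
have [mn|nm] := leqP m n.
  have [psiX _ _ siso] := hompsi; have TL := lcreate_tensor stoQ m (sigma i) (sigma j).
  rewrite (le_trans (opcoef_le _ _ _ (tensor_algebra_bounded stoP (psiX _ TL))))//.
  by rewrite siso// lcreate_opnorm.
have om := order_phi stoQ stoP hompsi psi_vproj (can_inj tauK) irrQ two_pointsQ mG.
by rewrite (order_ge_coef _ _ om nm) normc0.
Qed.

(* Approximate [phi (e n i j)] by a finite combination [\sum_m x_m f_m] and apply
   [psi]: the [n]-th coefficient is 1, while [x_m] is small for [m < n] and
   [psi f_m] has order at least [m]. *)
Lemma phi_coef_ge1 n i j : Gr (mpow P n) i j ->
  1 <= normc (opcoef (phi (lcreate P n i j)) n (sigma i) (sigma j)).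
Proof.
move=> ij; have [phiX _ _ piso] := homphi; have [psiX slin _ siso] := hompsi.
have TL := lcreate_tensor stoP n i j; set A := phi _.
have TA : TQ A by exact: phiX.
have cA : corner A (sigma i) (sigma j) = A by exact: phi_corner.
have oA : order_ge n A.
  exact: (order_phi stoP stoQ homphi phi_vproj (can_inj sigmaK) irrP two_points ij).
pose b m := opcoef A m (sigma i) (sigma j); rewrite -/(b n).
apply/ler_addgt0Pr => e e0.
(* The error is shared by [n.+1] coefficients of degree at most [n] and by the remainder [X - A]. *)
have e20 : 0 < e / n.+2%:R by rewrite divr_gt0// ltr0n.
have [N [x]] := corner_approx stoQ TA cA e20; set X := \sum_(m < N) _ => AX.
have TX : TQ X by exact: sum_lcreate_tensor.
have bAX : bounded_operator (A - X).
  by apply: bounded_sub; exact: tensor_algebra_bounded.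
pose d := e / n.+2%:R.
have xb m : Gr (mpow Q m) (sigma i) (sigma j) -> (m < N)%N ->
    normc (x m) <= normc (b m) + d.
  move=> mG mN; have : normc (opcoef (A - X) m (sigma i) (sigma j)) <= d.
    exact: le_trans (opcoef_le _ _ _ bAX) (ltW AX).
  rewrite opcoefB -/(b m) /X (opcoef_sum N (fun m => x m *: lcreate Q m (sigma i) (sigma j))).
  have -> : \sum_(k < N) opcoef (x k *: lcreate Q k (sigma i) (sigma j)) m (sigma i) (sigma j) = x m.
    rewrite (bigD1 (Ordinal mN))//= opcoefZ opcoef_lcreate// eqxx cmulr1 big1 ?caddr0// => k km.
    rewrite opcoefZ; have [kG|kG] := boolP (Gr (mpow Q k) (sigma i) (sigma j)); last first.
      by rewrite lcreate_nGr// opcoef0 cmulr0.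
    rewrite opcoef_lcreate//; case: eqP => [mk|_]; last exact: cmulr0.
    by case/eqP: km; apply: val_inj; rewrite /= mk.
  move=> bx; have -> : x m = b m - (b m - x m) by rewrite opprB addrC subrK.
  by rewrite (le_trans (normcD _ _))// normc_opp lerD2l.
have psiA : psi A = lcreate P n i j by exact: phiK.
have : opcoef (psi A) n i j = 1 by rewrite psiA opcoef_lcreate// eqxx.
have psiAX : psi A = (-1) *: psi (X - A) + psi X.
  rewrite -slin//; last first.
    have [_ lin _ _] := tensor_algebra_closed stoQ.
    by rewrite subE; apply: lin.
  by congr psi; rewrite scaleN1r opprB subrK.
rewrite psiAX opcoef_lin => one.
have TXA : TQ (X - A).
  by have [_ lin _ _] := tensor_algebra_closed stoQ; rewrite subE; apply: lin.
have h1 : normc (opcoef (psi (X - A)) n i j) <= d.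
  rewrite (le_trans (opcoef_le _ _ _ (tensor_algebra_bounded stoP (psiX _ TXA))))//.
  rewrite siso//; apply: le_trans (ltW AX).
  apply: opnorm_bound => [|y]; first exact: opnorm_ge0.
  rewrite -opprB -scaleN1r opZE (le_trans (l2normZ_le _ _))//.
  by rewrite normc_opp normc1 mul1r opnorm_le.
have h2 : normc (opcoef (psi X) n i j) <= normc (b n) + n.+1%:R * d.
  rewrite /X (phi_sum stoQ hompsi) (opcoef_sum N (fun m => x m *: psi (lcreate Q m (sigma i) (sigma j)))).
  apply: (@le_trans _ _ (\sum_(m < N) (m <= n)%N%:R * (normc (b m) + d))).
    elim: N x {X AX TX bAX psiAX one TXA h1} xb => [|N' IH] x' xb; first by rewrite !big_ord0 normc0.
    rewrite (sum_ord_recr N' (fun m => opcoef (x' m *: psi (lcreate Q m (sigma i) (sigma j))) n i j)).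
    rewrite (sum_ord_recr N' (fun m => (m <= n)%N%:R * (normc (b m) + d))).
    rewrite (le_trans (normcD _ _))// lerD//; last first.
      by apply: IH => m mG mN; apply: xb => //; exact: ltnW.
    rewrite opcoefZ normcM mulrC.
    have [mG|mG] := boolP (Gr (mpow Q N') (sigma i) (sigma j)).
      apply: ler_pM; rewrite ?normc_ge0//; last exact: xb.
      by rewrite (le_trans (psi_coef_bound _ _ _ _))// mG.
    rewrite lcreate_nGr// (phi0 stoQ hompsi (sigma i)) opcoef0 normc0 mul0r.
    by rewrite mulr_ge0 ?addr_ge0 ?normc_ge0// ltW.
  (* Among the degrees up to [n] only [b n] can be nonzero, because [A] has order at least [n]. *)
  have -> : normc (b n) + n.+1%:R * d = \sum_(m < n.+1) (normc (b m) + d).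
    rewrite mulr_natl big_split /= sumr_const card_ord; congr (_ + _); apply/esym.
    rewrite (bigD1 ord_max)//= big1 ?addr0// => m mn.
    rewrite /b (order_ge_coef _ _ oA) ?normc0//.
    by rewrite ltn_neqAle -ltnS ltn_ord andbT; apply: contra mn => /eqP mn; apply/eqP/val_inj.
  apply: (@sum_truncate_le _ (fun m => normc (b m) + d)) => m.
  by rewrite addr_ge0 ?normc_ge0// ltW.
have -> : e = d + n.+1%:R * d.
  by rewrite -[X in X + _]mul1r -mulrDl nat1r /d mulrC divfK// pnatr_eq0.
have := normcD (-1 * opcoef (psi (X - A)) n i j) (opcoef (psi X) n i j).
by rewrite one normc1 mulN1r normc_opp; move: h1 h2; lra.
Qed.

Lemma phi_graded n i j : Gr (mpow P n) i j ->
  Gr (mpow Q n) (sigma i) (sigma j) /\ exists2 u : R[i], normc u = 1 &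
    phi (lcreate P n i j) = u *: lcreate Q n (sigma i) (sigma j).
Proof.
move=> ij; have [phiX _ _ piso] := homphi.
have TL := lcreate_tensor stoP n i j; have := phi_coef_ge1 ij; set A := phi _ => A1.
have TA : TQ A by exact: phiX.
have bA := tensor_algebra_bounded stoQ TA; have rA := tensor_algebra_rcomm stoQ TA.
have cA : corner A (sigma i) (sigma j) = A by exact: phi_corner.
have nA : opnorm A <= 1 by rewrite piso// lcreate_opnorm.
(* Off the graph of Q^n the coefficient would be 0, against the lower bound 1; this is how edges are
   carried to [Q]. *)
move: A1; rewrite /opcoef; case E : (mkidx Q n _ _) => [s|]; last first.
  by rewrite normc0 ler10.
move/mkidxP: E => [sd st ss] A1.
have GQ : Gr (mpow Q n) (sigma i) (sigma j) by rewrite -sd -st -ss Gr_idx.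
have Av1 : l2norm (A (ket (vac Q (sigma j)))) <= 1.
  by rewrite (le_trans (contraction_le _ bA nA))// l2norm_ket.
split=> //; exists (A (ket (vac Q (sigma j))) s).
  apply/eqP; rewrite eq_le A1 andbT.
  exact: le_trans (coord_le _ _) Av1.
have TL' := lcreate_tensor stoQ n (sigma i) (sigma j).
have TuL c : TQ (c *: lcreate Q n (sigma i) (sigma j)).
  have [_ lin _ _] := tensor_algebra_closed stoQ.
  by rewrite -[_ *: _]addr0; apply: lin => //; exact: (tensor_algebra0 stoQ (sigma i)).
apply: (tensor_eq stoQ) => // k; apply: ell2P => t; rewrite opZE ell2ZE.
have [->|kj] := eqVneq k (sigma j); last first.
  rewrite lcreate_ket0 ?tgt_vac// ell20E cmulr0.
  by rewrite (corner_vac stoQ _ _ bA rA cA) (negbTE kj).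
have [s' [sd' st' ss' ->]] := lcreate_vac stoQ GQ.
have -> : s' = s by apply: idxP; rewrite ?sd ?st ?ss.
rewrite ketE; have [->|ts] := eqVneq t s; first by rewrite cmulr1.
by rewrite cmulr0; exact: (unit_coord Av1 A1).
Qed.

Lemma phi_ratio n m i j k : Gr (mpow P n) i j -> Gr (mpow P m) j k ->
  mpow P n i j * mpow P m j k / mpow P (n + m) i k =
  mpow Q n (sigma i) (sigma j) * mpow Q m (sigma j) (sigma k)
    / mpow Q (n + m) (sigma i) (sigma k).
Proof.
move=> ij jk; have ik := Gr_mpow_mul stoP ij jk.
have [Gij [u u1 phiij]] := phi_graded ij.
have [Gjk [v v1 phijk]] := phi_graded jk.
have [Gik [w w1 phiik]] := phi_graded ik.
have [_ _ pM _] := homphi.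
have := congr1 phi (lcreate_comp stoP ij jk).
rewrite pM; [|exact: lcreate_tensor..].
rewrite (phiZ stoP homphi _ i (lcreate_tensor stoP _ _ _)) phiij phijk phiik.
have -> : (u *: lcreate Q n (sigma i) (sigma j)) \o (v *: lcreate Q m (sigma j) (sigma k)) =
    (u * v) *: (lcreate Q n (sigma i) (sigma j) \o lcreate Q m (sigma j) (sigma k)).
  apply/funext => x; rewrite /= !opZE (linZ (lcreate_bounded stoQ _ _ _).1).
  by rewrite scalerA.
rewrite lcreate_comp// !scalerA.
move=> /(congr1 (fun A => opcoef A (n + m) (sigma i) (sigma k))).
(* Taking moduli removes the unimodular factors; squaring then removes the roots. *)
rewrite !opcoefZ opcoef_lcreate// eqxx !cmulr1 => /(congr1 (@normc _)).
rewrite !normcM u1 v1 w1 !mul1r mulr1 !normc_real.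
have s0 (a b c : R) : 0 <= Num.sqrt a * Num.sqrt b / Num.sqrt c.
  by rewrite !mulr_ge0 ?invr_ge0 ?sqrtr_ge0.
rewrite !ger0_norm// => /(congr1 (fun a => a ^+ 2)).
by rewrite !exprMn !exprVn !sqr_sqrtr ?mpow_ge0// => ->.
Qed.

End GradedIsomorphisms.
(** * Conjugate matrices have isomorphic algebras *)

Section Transport.
Local Open Scope classical_set_scope.
Local Open Scope ring_scope.
Context {R : realType}.

Section Map.
Context {T U : countType}.
Variables (P : T -> T -> R) (Q : U -> U -> R) (tau : U -> T).
Hypothesis tau_inj : injective tau.
Hypothesis PQ : forall n i j, mpow P n (tau i) (tau j) = mpow Q n i j.
Local Notation BP := (basis_index P).
Local Notation BQ := (basis_index Q).

(** The unitary that relabels the basis, written as a weighted shift with weights 1 so that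
    contractivity is already available; the same construction along the inverse bijection inverts
    it. *)
Definition transport : ell2 R BP -> ell2 R BQ :=
  wshift (fun _ _ => 1) (fun s : BQ => mkidx P (deg s) (tau (tgt s)) (tau (src s))).

Lemma transport_contractive : contractive_weights (fun _ _ => 1 : R[i])
  (fun s : BQ => mkidx P (deg s) (tau (tgt s)) (tau (src s))).
Proof.
split=> [s s' t /mkidxP[sd st ss] /mkidxP[sd' st' ss']|s t _]; last by rewrite normc1.
apply: idxP; first by rewrite -sd -sd'.
  by apply: tau_inj; rewrite -st -st'.
by apply: tau_inj; rewrite -ss -ss'.
Qed.

Lemma transportE (s : BQ) : exists t : BP,
  [/\ deg t = deg s, tgt t = tau (tgt s), src t = tau (src s) &
    forall x, transport x s = x t].
Proof.
have [t [td tt ts]] : exists t : BP,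
    [/\ deg t = deg s, tgt t = tau (tgt s) & src t = tau (src s)].
  by apply: mkidx_Gr; rewrite /Gr PQ; exact: Gr_idx.
exists t; split=> // x; rewrite (wshiftE transport_contractive) /wshift_fun.
have -> : mkidx P (deg s) (tau (tgt s)) (tau (src s)) = Some t by apply/mkidxP.
exact: cmul1r.
Qed.

Lemma transport_linear : linear transport.
Proof. exact: wshift_linear transport_contractive. Qed.

Lemma transport_norm x : l2norm (transport x) <= l2norm x.
Proof. exact: wshift_norm transport_contractive x. Qed.

End Map.

Arguments transport {T U} P Q tau x.
Arguments transport_linear {T U} P Q {tau}.
Arguments transport_norm {T U} P Q {tau}.

Context {T U : countType}.
Variables (P : T -> T -> R) (Q : U -> U -> R) (sigma : T -> U) (tau : U -> T).
Hypotheses (stoP : stochastic P) (stoQ : stochastic Q).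
Hypotheses (sigmaK : cancel sigma tau) (tauK : cancel tau sigma).
Hypothesis PQ : forall n i j, mpow P n (tau i) (tau j) = mpow Q n i j.
Local Notation BP := (basis_index P).
Local Notation BQ := (basis_index Q).

Let QP n i j : mpow Q n (sigma i) (sigma j) = mpow P n i j.
Proof. by rewrite -PQ !sigmaK. Qed.

Local Notation V := (transport P Q tau).
Local Notation W := (transport Q P sigma).

Lemma transportK x : W (V x) = x.
Proof.
apply: ell2P => s; have [t [td tt ts ->]] := transportE (can_inj sigmaK) QP s.
have [u [ud ut us ->]] := transportE (can_inj tauK) PQ t.
by congr (x _); apply: idxP; rewrite ?ud ?ut ?us ?td ?tt ?ts ?sigmaK.
Qed.

Lemma transport_ket (t : BP) : exists s : BQ,
  [/\ deg s = deg t, tgt s = sigma (tgt t), src s = sigma (src t) & V (ket t) = ket s].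
Proof.
have [s [sd st ss _]] := transportE (can_inj sigmaK) QP t.
exists s; split=> //; apply: ell2P => u.
have [t' [td tt ts ->]] := transportE (can_inj tauK) PQ u.
rewrite !ketE; congr (nat_of_bool _)%:R; apply/eqP/eqP => [t't|us].
  by apply: idxP; rewrite ?sd ?st ?ss -t't ?td ?tt ?ts ?tauK.
by apply: idxP; rewrite ?td ?tt ?ts us ?sd ?st ?ss ?sigmaK.
Qed.

Definition transport_op (A : ell2 R BP -> ell2 R BP) : ell2 R BQ -> ell2 R BQ :=
  fun y => V (A (W y)).

Lemma transport_op_bounded A : bounded_operator A ->
  bounded_operator (transport_op A).
Proof.
move=> bA; split=> [c x y|].
  rewrite /transport_op (transport_linear _ _ (can_inj sigmaK)) bA.1.
  by rewrite (transport_linear _ _ (can_inj tauK)).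
exists (opnorm A) => x; rewrite (le_trans (transport_norm _ _ (can_inj tauK) _))//.
rewrite (le_trans (opnorm_le _ bA))// ler_wpM2l ?opnorm_ge0//.
exact: transport_norm _ _ (can_inj sigmaK) _.
Qed.

Lemma transport_op_norm A : bounded_operator A ->
  opnorm (transport_op A) <= opnorm A.
Proof.
move=> bA; apply: opnorm_bound => [|x]; first exact: opnorm_ge0.
rewrite (le_trans (transport_norm _ _ (can_inj tauK) _))//.
rewrite (le_trans (opnorm_le _ bA))// ler_wpM2l ?opnorm_ge0//.
exact: transport_norm _ _ (can_inj sigmaK) _.
Qed.

Lemma transport_op_lin c A A' :
  transport_op (c *: A + A') = c *: transport_op A + transport_op A'.
Proof.
apply/funext => x; rewrite /transport_op opE [RHS]opE.
exact: (transport_linear _ _ (can_inj tauK)).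
Qed.

Lemma transport_op_sub A A' :
  transport_op (A - A') = transport_op A - transport_op A'.
Proof. by rewrite (subE A A') transport_op_lin -subE. Qed.

Lemma transport_op_comp A A' :
  transport_op (A \o A') = transport_op A \o transport_op A'.
Proof. by apply/funext => x; rewrite /transport_op /= transportK. Qed.

Lemma Arv_transport n a : Arv P n a -> Arv Q n (fun i j => a (tau i) (tau j)).
Proof.
move=> [a0 aoo]; split=> [i j ij|].
  by apply: a0; rewrite /Gr PQ.
apply: le_lt_trans aoo; apply: ge_ereal_sup => _ [j _ <-].
apply: ereal_sup_ubound; exists (tau j) => //.
apply: (reindex_esum _ _ tau); split=> //.
  by move=> i k _ _; exact: can_inj.
by move=> i _; exists (sigma i) => //; exact: sigmaK.
Qed.

End Transport.

Arguments transport_op {R T U} P Q sigma tau A.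

Section TransportAlgebra.
Local Open Scope classical_set_scope.
Local Open Scope ring_scope.
Context {R : realType} {T U : countType}.
Variables (P : T -> T -> R) (Q : U -> U -> R) (sigma : T -> U) (tau : U -> T).
Hypotheses (stoP : stochastic P) (stoQ : stochastic Q).
Hypotheses (sigmaK : cancel sigma tau) (tauK : cancel tau sigma).
Hypothesis PQ : forall n i j, mpow P n (tau i) (tau j) = mpow Q n i j.

Let QP n i j : mpow Q n (sigma i) (sigma j) = mpow P n i j.
Proof. by rewrite -PQ !sigmaK. Qed.

Local Notation Vop := (transport_op P Q sigma tau).

Lemma is_S_transport n a A : is_S P n a A ->
  is_S Q n (fun i j => a (tau i) (tau j)) (Vop A).
Proof.
move=> [bA SA]; split; first exact: transport_op_bounded.
move=> t s; rewrite /transport_op.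
have [t' [td tt ts ->]] := transport_ket tauK sigmaK QP t.
have [s' [sd st ss ->]] := transportE (can_inj tauK) PQ s.
by rewrite SA sd st ss td tt ts !PQ (inj_eq (can_inj tauK)).
Qed.

(** By minimality: the bounded operators whose transport lies in the algebra of [Q] form a closed
    operator algebra that contains the generators. *)
Lemma transport_tensor A : tensor_algebra P A -> tensor_algebra Q (Vop A).
Proof.
move=> TA; have [Qb Ql Qm Qc] := tensor_algebra_closed stoQ.
suff : [set A | bounded_operator A /\ tensor_algebra Q (Vop A)] A by case.
apply: TA; split; last first.
  move=> A' [n [a [aA SA]]]; split; first exact: SA.1.
  apply: (tensor_algebra_gen (Arv_transport sigmaK tauK PQ aA)).
  exact: is_S_transport.
split.
- by move=> A' [].
- move=> c A1 A2 [b1 T1] [b2 T2]; split; first exact: bounded_lin.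
  by rewrite transport_op_lin//; exact: Ql.
- move=> A1 A2 [b1 T1] [b2 T2]; split; first exact: bounded_comp.
  by rewrite (transport_op_comp sigmaK tauK PQ); exact: Qm.
- move=> A' bA' XA; split=> //; apply: Qc; first exact: transport_op_bounded.
  move=> e e0; have [A1 [b1 T1] A1e] := XA e e0; exists (Vop A1) => //.
  rewrite -transport_op_sub// (le_lt_trans _ A1e)//.
  by apply: transport_op_norm => //; exact: bounded_sub.
Qed.

End TransportAlgebra.

Section ConjugateIsomorphism.
Local Open Scope classical_set_scope.
Local Open Scope ring_scope.
Context {R : realType} {T U : countType}.
Variables (P : T -> T -> R) (Q : U -> U -> R).
Hypotheses (stoP : stochastic P) (stoQ : stochastic Q).

Lemma mpow_conj (sigma : T -> U) (tau : U -> T) :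
  cancel sigma tau -> cancel tau sigma ->
  (forall i j, P i j = Q (sigma i) (sigma j)) ->
  forall n i j, mpow P n i j = mpow Q n (sigma i) (sigma j).
Proof.
move=> sigmaK tauK PQ; elim=> [|n IH] i j /=.
  by rewrite (inj_eq (can_inj sigmaK)).
congr fine; rewrite (reindex_esum [set: T] [set: U] sigma).
  by apply: eq_esum => k _; rewrite PQ IH.
split=> //; first by move=> k l _ _; exact: can_inj.
by move=> k _; exists (tau k) => //; exact: tauK.
Qed.

(* Both rows sum to one, so agreement on the edges of [P] leaves no mass in [Q]
   elsewhere. *)
Lemma conjugate_total (sigma : T -> U) : injective sigma ->
  (forall i j, Gr P i j -> P i j = Q (sigma i) (sigma j)) ->
  forall i j, P i j = Q (sigma i) (sigma j).
Proof.
move=> sinj PQ i j; have [/PQ//|nij] := boolP (Gr P i j).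
have le k : P i k <= Q (sigma i) (sigma k).
  have [/PQ->//|nik] := boolP (Gr P i k).
  by rewrite (le_trans _ (stoch_ge0 stoQ _ _))// leNgt.
apply/eqP; rewrite eq_le le /= leNgt; apply/negP => lt.
rewrite -subr_gt0 in lt.
(* The tolerance is the supposed excess of [Q] over [P] at (i, j). Replacing the entry at [j] by its
   larger counterpart then pushes a finite part of the row of [Q] above 1. *)
have [F uF] := esum_fin_approx (stoch_ge0 stoP i) (stoP.2 i) lt.
apply/negP; rewrite -leNgt.
pose G := j :: [seq k <- F | k != j].
have uG : uniq G by rewrite /= filter_uniq// andbT mem_filter eqxx.
have uQ : uniq (map sigma G) by rewrite map_inj_uniq.
have := stoch_sum_le1 stoQ (sigma i) uQ; rewrite big_map big_cons.
have -> : \sum_(k <- F) P i k = \sum_(k <- F | k == j) P i k + \sum_(k <- F | k != j) P i k.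
  by rewrite (bigID (fun k => k == j)).
have : \sum_(k <- F | k != j) P i k <= \sum_(k <- [seq k <- F | k != j]) Q (sigma i) (sigma k).
  by rewrite big_filter; apply: ler_sum.
have : \sum_(k <- F | k == j) P i k <= P i j.
  have [jF|jF] := boolP (j \in F).
    by rewrite big_mkcond (bigD1_seq j)//= eqxx big1 ?addr0// => k /negbTE->.
  rewrite big_seq_cond big1 ?stoch_ge0// => k /andP[kF /eqP kj].
  by rewrite kj (negbTE jF) in kF.
by lra.
Qed.

Lemma conjugate_isomorphism : conjugate P Q ->
  exists phi, isometric_isomorphism (tensor_algebra P) (tensor_algebra Q) phi.
Proof.
move=> [sigma [[tau sigmaK tauK] /(conjugate_total (can_inj sigmaK)) PQ0]].
have QP n i j : mpow Q n (sigma i) (sigma j) = mpow P n i j.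
  by rewrite (mpow_conj sigmaK tauK PQ0).
have PQ n i j : mpow P n (tau i) (tau j) = mpow Q n i j by rewrite -QP !tauK.
have VK A : transport_op Q P tau sigma
    (transport_op P Q sigma tau A) = A.
  apply/funext => x; rewrite /transport_op.
  by rewrite !(transportK sigmaK tauK PQ).
have WK A : transport_op P Q sigma tau
    (transport_op Q P tau sigma A) = A.
  apply/funext => x; rewrite /transport_op.
  by rewrite !(transportK tauK sigmaK QP).
exists (transport_op P Q sigma tau); split.
- split.
  + by move=> A TA; exact: transport_tensor.
  + by move=> A A' _ _ AA'; rewrite -(VK A) AA' VK.
  + move=> A TA; exists (transport_op Q P tau sigma A) => //.
    exact: (transport_tensor stoP tauK sigmaK QP).
- by move=> c A A' _ _; exact: transport_op_lin.
- by move=> A A' _ _; exact: (transport_op_comp sigmaK tauK PQ).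
- move=> A TA; have bA := tensor_algebra_bounded stoP TA.
  apply/eqP; rewrite eq_le; apply/andP; split.
    exact: (transport_op_norm _ sigmaK tauK).
  rewrite -[in leLHS](VK A); apply: (transport_op_norm _ tauK sigmaK).
  exact: (transport_op_bounded _ sigmaK tauK).
Qed.

End ConjugateIsomorphism.
(** * Doob transforms *)

Section MultiplicativeRatios.
Local Open Scope ring_scope.
Context {R : realType} {T : Type}.
Variables (G : nat -> T -> T -> Prop) (r : nat -> T -> T -> R) (o : T).
Hypothesis G0 : G 0 o o.
Hypothesis GM : forall n m i j k, G n i j -> G m j k -> G (n + m)%N i k.
Hypothesis Gex : forall i j, exists n, G n.+1 i j.
Hypothesis r0 : forall n i j, G n i j -> 0 < r n i j.
Hypothesis rM : forall n m i j k, G n i j -> G m j k ->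
  r n i j * r m j k = r (n + m)%N i k.

Lemma ratio_loop_pow k n : G n o o -> G (k * n)%N o o /\ r (k * n) o o = r n o o ^+ k.
Proof.
move=> Gn; elim: k => [|k [Gk IH]].
  split=> //; rewrite mul0n expr0; have := rM G0 G0; rewrite addn0 => r00.
  by apply: (mulfI (lt0r_neq0 (r0 G0))); rewrite r00 mulr1.
by rewrite mulSn; split; [exact: GM Gk|rewrite -(rM Gn Gk) IH exprS].
Qed.

(** [lam] is a root of the ratio of one loop. Any other loop is compared with it at a common power,
    where positive roots are unique; the period of the graph does not enter. *)
Lemma ratio_loop : exists2 lam : R, 0 < lam & forall n, G n o o -> r n o o = lam ^+ n.
Proof.
have [n0 Gn0] := Gex o o; pose lam := r n0.+1 o o `^ (n0.+1%:R^-1).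
have lam0 : 0 < lam by apply: powR_gt0; exact: r0.
have lamE : lam ^+ n0.+1 = r n0.+1 o o.
  rewrite -powR_mulrn ?ltW// -powRrM mulVf ?pnatr_eq0// powRr1// ltW//.
  exact: r0.
exists lam => // n Gn; apply/eqP.
rewrite -(@eqrXn2 _ n0.+1) ?exprn_ge0 ?ltW//; last exact: r0.
rewrite -exprM mulnC exprM lamE -(ratio_loop_pow n0.+1 Gn).2 mulnC.
by rewrite (ratio_loop_pow n Gn0).2.
Qed.

(** [g j] is the ratio along a chosen path from [o] to [j], normalised by [lam]. It is independent
    of the path, since closing two paths by the same return gives loops at [o], whose ratios are
    known. *)
Lemma ratio_potential : exists lam (g : T -> R), [/\ 0 < lam, (forall i, 0 < g i) &
  forall n i j, G n i j -> r n i j * g i = lam ^+ n * g j].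
Proof.
have [lam lam0 rlam] := ratio_loop.
have /choice[N NP] : forall j, exists n, G n o j.
  by move=> j; have [n] := Gex o j; exists n.+1.
have lamn n : 0 < lam ^+ n by rewrite exprn_gt0.
pose g j := r (N j) o j / lam ^+ N j.
have gE n j : G n o j -> r n o j = lam ^+ n * g j.
  move=> Gn; have [m Gm] := Gex j o.
  have rm0 := lt0r_neq0 (r0 Gm).
  apply: (mulIf rm0); rewrite rM// rlam; last exact: GM Gm.
  rewrite -mulrA /g mulrAC rM// rlam; last exact: GM Gm.
  by rewrite !exprD [X in X / _]mulrC mulfK ?gt_eqF// mulrC.
exists lam, g; split=> // [i|n i j ij].
  by rewrite divr_gt0//; exact: r0.
have Gij := GM (NP i) ij.
apply: (mulfI (lt0r_neq0 (lamn (N i)))).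
rewrite mulrCA mulrC -gE// rM// (gE _ _ Gij) exprD; ring.
Qed.

End MultiplicativeRatios.

(** * Spectral radii under exponential comparison *)

Section LimsupComparison.
Local Open Scope classical_set_scope.
Local Open Scope ring_scope.
Context {R : realType}.
Implicit Types (u v : nat -> R).

Lemma limn_esup_inf (f : nat -> \bar R) :
  limn_esup f = ereal_inf (range (esups f)).
Proof. by rewrite limn_esup_lim; apply/cvg_lim => //; exact: cvg_esups_inf. Qed.

Lemma limn_esup_frequently (f : nat -> \bar R) (a : \bar R) : (a < limn_esup f)%E ->
  forall N, exists2 n, (N <= n)%N & (a < f n)%E.
Proof.
rewrite limn_esup_inf => af N.
have : (a < esups f N)%E.
  by apply: lt_le_trans af _; apply: ereal_inf_lbound; exists N.
by move=> /ereal_sup_gt[_ [n /= Nn <-] an]; exists n.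
Qed.

Lemma frequently_limn_esup (f : nat -> \bar R) (a : \bar R) :
  (forall N, exists2 n, (N <= n)%N & (a <= f n)%E) -> (a <= limn_esup f)%E.
Proof.
rewrite limn_esup_inf => fa; apply: le_ereal_inf_tmp => _ [N _ <-].
have [n Nn an] := fa N; apply: (le_trans an).
by apply: ereal_sup_ubound; exists n.
Qed.

Lemma bernoulli (d : R) n : 0 <= d -> 1 + n%:R * d <= (1 + d) ^+ n.
Proof.
move=> d0; elim: n => [|n IH]; first by rewrite mul0r addr0 expr0.
rewrite exprS -natr1 mulrDl mul1r.
have : (1 + d) * (1 + n%:R * d) <= (1 + d) * (1 + d) ^+ n.
  by rewrite ler_wpM2l// addr_ge0.
have : 0 <= n%:R * d * d by rewrite !mulr_ge0.
by nra.
Qed.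

Lemma expr_unbounded (q A : R) : 1 < q -> exists M, forall n, (M <= n)%N -> A <= q ^+ n.
Proof.
move=> q1; have d0 : 0 < q - 1 by rewrite subr_gt0.
exists (Num.bound `|A / (q - 1)|) => n Mn.
have -> : q = 1 + (q - 1) by rewrite addrC subrK.
apply: le_trans (bernoulli n (ltW d0)).
have : A / (q - 1) <= n%:R.
  apply: le_trans (ltW (le_lt_trans (ler_norm _) (archi_boundP _))) _ => //.
  by rewrite ler_nat.
by rewrite ler_pdivrMr//; lra.
Qed.

Lemma root_powE (a : R) n : 0 <= a -> (a ^+ n.+1) `^ (n.+1%:R^-1) = a.
Proof.
move=> a0; rewrite -powR_mulrn// -powRrM divff ?pnatr_eq0// powRr1//.
Qed.

(** If [lam] exceeded 1, one could fit s < rho < t < lam s. Frequently u_n is at least s^n, so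
    v_(n+k) is at least c (lam s)^n, which eventually beats t^(n+k); the second limsup would be at
    least t. *)
Lemma root_limsup_le1 u v (c lam rho : R) k :
  (forall n, 0 <= u n) -> 0 < c -> 0 < lam -> 0 < rho ->
  (forall n, c * lam ^+ n * u n <= v (n + k)%N) ->
  limn_esup (fun n => (u n `^ n%:R^-1)%:E) = rho%:E ->
  limn_esup (fun n => (v n `^ n%:R^-1)%:E) = rho%:E -> lam <= 1.
Proof.
move=> u0 c0 lam0 rho0 uv urho vrho; rewrite leNgt; apply/negP => lam1.
have [s [t [s0 srho trho ts]]] : exists s t : R,
    [/\ 0 < s, s < rho, rho < t & t < lam * s].
  have lamV : lam * lam^-1 = 1 by rewrite divff ?gt_eqF.
  have lamV0 : 0 < lam^-1 by rewrite invr_gt0.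
  have lamV1 : lam^-1 < 1 by rewrite invf_lt1.
  (* [s] is the midpoint of rho / lam and rho, and [t] the midpoint of rho and lam s. *)
  exists (rho * (1 + lam^-1) / 2), (rho * (3 + lam) / 4); split; [|nra..|].
    by rewrite divr_gt0// mulr_gt0// addr_gt0.
  have -> : lam * (rho * (1 + lam^-1) / 2) = rho * (lam + lam * lam^-1) / 2 by ring.
  by rewrite lamV; nra.
have t0 : 0 < t by exact: lt_trans trho.
have qt : 1 < lam * s / t by rewrite ltr_pdivlMr// mul1r.
suff : (t%:E <= rho%:E)%E by rewrite lee_fin leNgt trho.
rewrite -vrho; apply: frequently_limn_esup => N.
have [M MP] := expr_unbounded (t ^+ k / c) qt.
have sl : (s%:E < limn_esup (fun n => (u n `^ n%:R^-1)%:E))%E by rewrite urho lte_fin.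
(* [n] must be positive for the root to be undone: at 0 the exponent [n%:R^-1] is 0. *)
have [n nM un] := limn_esup_frequently sl (maxn N (maxn M 1)).
rewrite !geq_max in nM; have /and3P[Nn Mn n1] := nM.
exists (n + k)%N; first exact: leq_trans (leq_addr _ _).
have sn : s ^+ n <= u n.
  rewrite lte_fin in un; have -> : u n = (u n `^ n%:R^-1) ^+ n.
    by rewrite -powR_mulrn ?powR_ge0// -powRrM mulVf ?powRr1// pnatr_eq0 -lt0n.
  by rewrite ler_pXn2r ?nnegrE ?powR_ge0// ltW.
have tv : t ^+ (n + k) <= v (n + k)%N.
  apply: le_trans (uv n).
  apply: (@le_trans _ _ (c * lam ^+ n * s ^+ n)); last first.
    by rewrite ler_wpM2l// mulr_ge0 ?exprn_ge0// ltW.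
  have tn0 : 0 < t ^+ n by rewrite exprn_gt0.
  have -> : c * lam ^+ n * s ^+ n = (lam * s / t) ^+ n * c * t ^+ n.
    by rewrite [RHS]mulrAC expr_div_n divfK ?gt_eqF// exprMn [RHS]mulrC mulrA.
  by rewrite exprD mulrC ler_pM2r// -ler_pdivrMr// MP.
rewrite lee_fin; have nk : (n + k)%N = (n + k).-1.+1 by rewrite prednK// addn_gt0 n1.
rewrite -{1}(root_powE (n + k).-1 (ltW t0)) -nk.
by apply: ge0_ler_powR; rewrite ?invr_ge0 ?nnegrE ?exprn_ge0 ?(ltW t0)// (le_trans _ tv)// exprn_ge0// ltW.
Qed.

Context {T : countType}.
Variable P : T -> T -> R.
Hypotheses (stoP : stochastic P) (irrP : irreducible P).

Lemma mpow_loop_pow i n k : mpow P n i i ^+ k <= mpow P (k * n) i i.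
Proof.
elim: k => [|k IH]; first by rewrite /= eqxx.
rewrite exprS mulSn; apply: le_trans (mpow_mul_le stoP _ _ _ i _).
by rewrite ler_wpM2l ?mpow_ge0.
Qed.

(** The powers of one loop keep the roots frequently above a positive number, and all entries are at
    most 1. *)
Lemma spectral_radius_pos_fin i :
  exists2 rho : R, 0 < rho & spectral_radius P i = rho%:E.
Proof.
have [n0 Gn0] := irr_mpow_pos stoP i i irrP.
pose a := mpow P n0.+1 i i `^ n0.+1%:R^-1.
have a0 : 0 < a by apply: powR_gt0.
have al : (a%:E <= spectral_radius P i)%E.
  apply: frequently_limn_esup => N; exists (N.+1 * n0.+1)%N.
    by rewrite (leq_trans (leqnSn N))// leq_pmulr.
  rewrite lee_fin natrM invfM mulrC powRrM.
  apply: (@le_trans _ _ ((mpow P n0.+1 i i ^+ N.+1) `^ n0.+1%:R^-1 `^ N.+1%:R^-1)).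
    by rewrite powRAC root_powE// mpow_ge0.
  apply: ge0_ler_powR; rewrite ?invr_ge0 ?nnegrE ?powR_ge0//.
  apply: ge0_ler_powR; rewrite ?invr_ge0 ?nnegrE ?exprn_ge0 ?mpow_ge0//.
  exact: mpow_loop_pow.
have l1 : (spectral_radius P i <= 1%:E)%E.
  rewrite leNgt; apply/negP => /limn_esup_frequently/(_ 0%N)[n _].
  rewrite lte_fin ltNge => /negP; apply.
  apply: (@le_trans _ _ (1 `^ n%:R^-1)); last by rewrite powR1.
  by apply: ge0_ler_powR; rewrite ?invr_ge0 ?nnegrE ?mpow_ge0 ?mpow_le1.
have fin : spectral_radius P i \is a fin_num.
  rewrite fin_numE; apply/andP; split.
    by apply/eqP => E; move: al; rewrite E leeNy_eq.
  by apply/eqP => E; move: l1; rewrite E leye_eq.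
exists (fine (spectral_radius P i)); last by rewrite fineK.
by rewrite -lte_fin fineK//; apply: lt_le_trans al; rewrite lte_fin.
Qed.

End LimsupComparison.

(** * From equal ratios to equal matrices *)

Section DoobTransform.
Local Open Scope classical_set_scope.
Local Open Scope ring_scope.
Context {R : realType} {T U : countType}.
Variables (P : T -> T -> R) (Q : U -> U -> R) (sigma : T -> U) (tau : U -> T).
Hypotheses (stoP : stochastic P) (stoQ : stochastic Q).
Hypotheses (irrP : irreducible P) (irrQ : irreducible Q).
Hypotheses (sigmaK : cancel sigma tau) (tauK : cancel tau sigma).

Lemma doob_of_ratio (i0 : T) :
  (forall n i j, Gr (mpow P n) i j = Gr (mpow Q n) (sigma i) (sigma j)) ->
  (forall n m i j k, Gr (mpow P n) i j -> Gr (mpow P m) j k ->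
    mpow P n i j * mpow P m j k / mpow P (n + m) i k =
    mpow Q n (sigma i) (sigma j) * mpow Q m (sigma j) (sigma k)
      / mpow Q (n + m) (sigma i) (sigma k)) ->
  exists lam (g : T -> R), [/\ 0 < lam, (forall i, 0 < g i) &
    forall n i j, mpow P n i j * g i =
      lam ^+ n * mpow Q n (sigma i) (sigma j) * g j].
Proof.
move=> GPQ ratio.
pose r n i j := mpow P n i j / mpow Q n (sigma i) (sigma j).
have [lam [g [lam0 g0 rg]]] : exists lam (g : T -> R), [/\ 0 < lam,
    (forall i, 0 < g i) &
    forall n i j, Gr (mpow P n) i j -> r n i j * g i = lam ^+ n * g j].
  apply: (@ratio_potential _ _ (fun n i j => Gr (mpow P n) i j) r i0).
  - exact: Gr_mpow0.
  - by move=> n m i j k; exact: Gr_mpow_mul.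
  - by move=> i j; exact: irr_mpow_pos.
  - by move=> n i j ij; rewrite divr_gt0//; move: ij; rewrite GPQ.
  - move=> n m i j k ij jk; have ik := Gr_mpow_mul stoP ij jk.
    have := ratio n m i j k ij jk; rewrite /r.
    have := ij; have := jk; have := ik; rewrite !GPQ /Gr => qik qjk qij pe.
    have pik : mpow P (n + m) i k != 0 by rewrite gt_eqF.
    have -> : mpow P n i j / mpow Q n (sigma i) (sigma j) *
      (mpow P m j k / mpow Q m (sigma j) (sigma k)) =
      mpow P n i j * mpow P m j k / mpow P (n + m) i k * mpow P (n + m) i k /
      (mpow Q n (sigma i) (sigma j) * mpow Q m (sigma j) (sigma k)).
      by rewrite divfK// invfM mulrACA.
    rewrite pe; field; do ?[apply/andP; split]; by rewrite gt_eqF.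
exists lam, g; split=> // n i j.
have [ij|nij] := boolP (Gr (mpow P n) i j).
  rewrite [RHS]mulrAC -(rg n i j)// /r.
  have := ij; rewrite GPQ /Gr => qij.
  by field; rewrite gt_eqF.
have nQ := nij; rewrite GPQ in nQ.
have z (a : R) : 0 <= a -> ~~ (0 < a) -> a = 0.
  by move=> a0; rewrite -leNgt => a1; apply/eqP; rewrite eq_le a0 a1.
by rewrite (z _ (mpow_ge0 stoP _ _ _) nij) (z _ (mpow_ge0 stoQ _ _ _) nQ) mul0r mulr0 mul0r.
Qed.

(** Moves a loop from [y] to [x] at the price of a fixed factor and a fixed extra length, so that
    the base points of the two spectral radii need not correspond under [sigma]. *)
Lemma loop_through (S : countType) (K : S -> S -> R) (stoK : stochastic K)
    a n b (x y : S) :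
  mpow K a x y * mpow K b y x * mpow K n y y <= mpow K (n + (a + b)) x x.
Proof.
have -> : (n + (a + b) = a + (n + b))%N by rewrite addnCA.
apply: le_trans (mpow_mul_le stoK _ _ _ y _); rewrite -mulrA ler_wpM2l ?mpow_ge0//.
by rewrite mulrC; exact: mpow_mul_le.
Qed.

(** On loops [g] cancels, which leaves the factor [lam ^+ n] alone. The limsup comparison in both
    directions bounds [lam] and its inverse by 1. *)
Lemma doob_eigenvalue (lam : R) (g : T -> R) (i0 : T) (j0 : U) :
  0 < lam -> (forall i, 0 < g i) ->
  (forall n i j, mpow P n i j * g i = lam ^+ n * mpow Q n (sigma i) (sigma j) * g j) ->
  spectral_radius P i0 = spectral_radius Q j0 -> lam = 1.
Proof.
move=> lam0 g0 PQ rhoE.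
have [rho rho0 rhoP] := spectral_radius_pos_fin stoP irrP i0.
have rhoQ : spectral_radius Q j0 = rho%:E by rewrite -rhoE.
have loops n i : mpow P n i i = lam ^+ n * mpow Q n (sigma i) (sigma i).
  by apply: (mulIf (lt0r_neq0 (g0 i))); rewrite PQ.
apply/eqP; rewrite eq_le; apply/andP; split.
  have [a Ga] := irr_mpow stoP i0 (tau j0) irrP.
  have [b Gb] := irr_mpow stoP (tau j0) i0 irrP.
  apply: (@root_limsup_le1 _ (fun n => mpow Q n j0 j0) (fun n => mpow P n i0 i0)
    (mpow P a i0 (tau j0) * mpow P b (tau j0) i0) lam rho (a + b)) => //.
  - by move=> n; exact: mpow_ge0.
  - exact: mulr_gt0.
  - move=> n; apply: le_trans (loop_through stoP a n b i0 (tau j0)).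
    by rewrite loops tauK mulrA.
have [a Ga] := irr_mpow stoQ j0 (sigma i0) irrQ.
have [b Gb] := irr_mpow stoQ (sigma i0) j0 irrQ.
rewrite -invf_le1//; apply: (@root_limsup_le1 _ (fun n => mpow P n i0 i0) (fun n => mpow Q n j0 j0)
  (mpow Q a j0 (sigma i0) * mpow Q b (sigma i0) j0) lam^-1 rho (a + b)) => //.
- by move=> n; exact: mpow_ge0.
- exact: mulr_gt0.
- by rewrite invr_gt0.
- move=> n; apply: le_trans (loop_through stoQ a n b j0 (sigma i0)).
  rewrite loops -mulrA ler_wpM2l ?mulr_ge0 ?mpow_ge0//.
  by rewrite mulrA exprVn mulVf ?mul1r// gt_eqF// exprn_gt0.
Qed.

Lemma esum_scale (S : countType) (f : S -> R) (c : R) : (forall i, 0 <= f i) ->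
  0 <= c -> (\esum_(i in [set: S]) (f i)%:E = 1)%E ->
  (\esum_(i in [set: S]) (c * f i)%:E = c%:E)%E.
Proof.
move=> f0 c0 f1; apply/eqP; rewrite eq_le; apply/andP; split.
  apply: esum_le_fin => [i|F uF]; first exact: mulr_ge0.
  rewrite -mulr_sumr -[leRHS]mulr1 ler_wpM2l// -lee_fin -f1.
  exact: le_sum_esum.
apply/lee_addgt0Pr => e e0; have c1 : 0 < c + 1 by rewrite ltr_wpDl.
have [F uF Ff] := esum_fin_approx f0 f1 (divr_gt0 e0 c1).
have := @le_sum_esum _ _ (fun i => c * f i) F (fun i => mulr_ge0 c0 (f0 i)) uF.
rewrite -mulr_sumr => /(leeD2r e%:E); apply: le_trans; rewrite -EFinD lee_fin.
have : e / (c + 1) * (c + 1) = e by rewrite divfK// gt_eqF.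
have : 0 < e / (c + 1) by rewrite divr_gt0.
move: Ff; set S' := \sum_(i <- F) _; set d := e / _ => Sd d0 dE.
by rewrite -dE; nra.
Qed.

Lemma stoch_row_reindex i :
  (\esum_(j in [set: T]) (Q (sigma i) (sigma j))%:E = 1)%E.
Proof.
rewrite -(stoQ.2 (sigma i)).
rewrite (reindex_esum [set: T] [set: U] sigma)//.
split=> //; first by move=> k l _ _; exact: can_inj.
by move=> k _; exists (tau k) => //; exact: tauK.
Qed.

(** Summing the relation over [j] with the row sums of [P] shows that [g], carried over by [tau], is
    harmonic for [Q]. Dividing it by g(i) g(j) and using the row sums of [Q] shows that 1/g is
    harmonic for [P]. *)
Lemma doob_conjugate (g : T -> R) : (forall i, 0 < g i) ->
  (forall i j, P i j * g i = Q (sigma i) (sigma j) * g j) ->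
  strong_liouville P \/ strong_liouville Q ->
  forall i j, P i j = Q (sigma i) (sigma j).
Proof.
move=> g0 PQ liou; suff gc i j : g i = g j.
  by move=> i j; apply: (mulIf (lt0r_neq0 (g0 i))); rewrite PQ (gc i j).
case: liou => [liouP|liouQ].
  apply: invr_inj; apply: (liouP (fun i => (g i)^-1)); split=> [k|k].
    by rewrite invr_gt0.
  rewrite -[RHS](esum_scale _ _ (stoch_row_reindex k)); first last.
  - by rewrite invr_ge0 ltW.
  - by move=> l; exact: stoch_ge0.
  apply: eq_esum => l _; congr EFin.
  apply: (mulIf (lt0r_neq0 (g0 k))); rewrite mulrAC PQ.
  by rewrite mulfK ?gt_eqF// mulrAC mulVf ?mul1r// gt_eqF.
have := liouQ (fun k => g (tau k)) _ (sigma i) (sigma j); rewrite !sigmaK; apply.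
split=> [k|k] //; rewrite -[k]tauK sigmaK.
rewrite (reindex_esum [set: T] [set: U] sigma); last first.
  split=> //; first by move=> l l' _ _; exact: can_inj.
  by move=> l _; exists (tau l) => //; exact: tauK.
rewrite -[RHS](esum_scale _ _ (stoP.2 (tau k))); first last.
- exact: ltW.
- by move=> l; exact: stoch_ge0.
by apply: eq_esum => l _; rewrite sigmaK -PQ mulrC.
Qed.

End DoobTransform.

(** * Assembly of the equivalence *)

Lemma singleton_row (R : realType) (T : countType) (P : T -> T -> R) :
  stochastic P -> (forall k l : T, k = l) -> forall i j, P i j = 1%R.
Proof.
move=> stoP T1 i j; have := stoP.2 i.
have -> : [set: T]%classic = [set j]%classic.
  by apply/seteqP; split => // k _ /=; exact: T1.
rewrite esum_set1 ?lee_fin ?stoch_ge0// => /eqP.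
by rewrite eqe => /eqP.
Qed.

Lemma isomorphism_conjugate (R : realType) (T U : countType)
    (P : T -> T -> R) (Q : U -> U -> R) (i0 : T) (j0 : U) phi :
  stochastic P -> stochastic Q -> irreducible P -> irreducible Q ->
  spectral_radius P i0 = spectral_radius Q j0 ->
  strong_liouville P \/ strong_liouville Q ->
  isometric_isomorphism (tensor_algebra P) (tensor_algebra Q) phi ->
  conjugate P Q.
Proof.
move=> stoP stoQ irrP irrQ rhoE liou iso.
have homphi := isometric_isomorphism_hom iso.
have [psi [hompsi phiK psiK]] := isometric_isomorphism_inverse
  (tensor_algebra_closed stoP) (tensor_algebra_closed stoQ) iso.
have /choice[sigma sigmaP] : forall i, exists j, phi (vproj P i) = vproj Q j.
  by move=> i; exact: hom_vproj homphi hompsi phiK psiK.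
have /choice[tau tauP] : forall j, exists i, psi (vproj Q j) = vproj P i.
  by move=> j; exact: hom_vproj hompsi homphi psiK phiK.
have sigmaK : cancel sigma tau.
  move=> i; apply: (vproj_inj stoP).
  by rewrite -tauP -sigmaP phiK//; exact: vproj_tensor.
have tauK : cancel tau sigma.
  move=> j; apply: (vproj_inj stoQ).
  by rewrite -sigmaP -tauP psiK//; exact: vproj_tensor.
exists sigma; split; first by exists tau.
suff PQ i j : P i j = Q (sigma i) (sigma j) by [].
(* With one state the isomorphism may fail to be graded, but then both matrices have the single
   entry 1. *)
move: i j; have [two|one] := pselect (exists k l : T, k != l); last first.
  have T1 (k l : T) : k = l.
    by apply/eqP; apply: contrapT => /negP kl; apply: one; exists k, l.
  have U1 (k l : U) : k = l by rewrite -(tauK k) (T1 (tau k) (tau l)) tauK.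
  by move=> i j; rewrite (singleton_row stoP)// (singleton_row stoQ).
have twoQ : exists k l : U, k != l.
  have [k [l kl]] := two; exists (sigma k), (sigma l).
  by rewrite (inj_eq (can_inj sigmaK)).
(* [phi] and its inverse each give one inclusion of the graphs. *)
have GPQ n i j : Gr (mpow P n) i j = Gr (mpow Q n) (sigma i) (sigma j).
  apply/idP/idP => [ij|ij].
    by have [] := phi_graded stoP stoQ irrP irrQ homphi hompsi phiK sigmaK tauK sigmaP two ij.
  have [] := phi_graded stoQ stoP irrQ irrP hompsi homphi psiK tauK sigmaK tauP twoQ ij.
  by rewrite !sigmaK.
have [lam [g [lam0 g0 PQ]]] := doob_of_ratio stoP stoQ irrP i0 GPQ
  (phi_ratio stoP stoQ irrP irrQ homphi hompsi phiK sigmaK tauK sigmaP two).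
have lam1 := doob_eigenvalue stoP stoQ irrP irrQ tauK lam0 g0 PQ rhoE.
apply: (doob_conjugate stoP stoQ sigmaK tauK g0) => // i j.
by have := PQ 1%N i j; rewrite lam1 expr1n mul1r !mpow1.
Qed.

Theorem corollary3p8 (R : realType) (OmegaP OmegaQ : countType)
    (P : OmegaP -> OmegaP -> R) (Q : OmegaQ -> OmegaQ -> R)
    (i0 : OmegaP) (j0 : OmegaQ) :
  stochastic P -> stochastic Q ->
  irreducible P -> irreducible Q ->
  spectral_radius P i0 = spectral_radius Q j0 ->
  strong_liouville P \/ strong_liouville Q ->
  (exists phi, isometric_isomorphism (tensor_algebra P) (tensor_algebra Q) phi)
  <-> conjugate P Q.
Proof.
move=> stoP stoQ irrP irrQ rhoE liou; split=> [[phi iso]|].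
  exact: isomorphism_conjugate rhoE liou iso.
exact: conjugate_isomorphism.
Qed.
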